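(* Let $d\ge 2$ be an integer and let $\beta\in\mathbb{C}$ satisfy $\beta^d=1$, $\beta\neq 1$. Let $(k,m)\in\mathbb{N}\times\mathbb{N}^*$ and let $\boldsymbol{z}=(z_i)_{i\ge1}\in\mathcal{M}_{k,m}\setminus\{\boldsymbol{0}\}$ be a fixed point of the map $F_{k,m}\colon\mathcal{M}_{k,m}\to\mathcal{M}_{k,m}$. Let $k'$ be the preperiod of the sequence $\boldsymbol{z}$ and $m'$ its period. Then: (1) the polynomial $P(t)=t^d+z_1\in\mathbb{C}[t]$ is post-critically finite and $\boldsymbol{z}=(P^{\circ j}(0))_{j\ge1}$; in particular, the critical value $z_1$ of $P$ is preperiodic of preperiod $k'$ to a cycle of period $m'$, whose multiplier we denote by $\lambda$; (2) there exists a partial order $\preceq$ on $\mathbb{N}\times\mathbb{N}^*$ (namely the one defined in the context) such that $(k',m')\preceq(k,m)$ if and only if $\mathcal{M}_{k',m'}\subseteq\mathcal{M}_{k,m}$ is an $F_{k,m}$-invariant subspace and the restriction of $F_{k,m}$ to $\mathcal{M}_{k',m'}$ is $F_{k',m'}$; (3) if $k+m-1\ge2$, then $F_{k,m}\colon\mathcal{M}_{k,m}\to\mathcal{M}_{k,m}$ and $G_{k,m}\colon\mathbb{C}^{k+m-1}\to\mathbb{C}^{k+m-1}$ are holomorphically conjugate; (4) $\operatorname{Spec}D_{\boldsymbol{z}}F_{k',m'}\subset\mathbb{C}\setminus\overline{\mathbb{D}}$, i.e. every eigenvalue of $D_{\boldsymbol z}F_{k',m'}$ (acting on $\mathcal{M}_{k',m'}$)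 has modulus strictly greater than $1$; (5) if $(k,m)\neq(k',m')$, then $$\operatorname{Spec}\left((D_{\boldsymbol{z}}F_{k,m})^*|_{\mathcal{M}_{k',m'}^0}\right)=\begin{cases}\{0\}&\text{if }k'=0,\\ \{\mu\in\mathbb{C}\mid\mu^m=\lambda^{m/m'},\ \mu^{m'}\neq\lambda\}&\text{if }k'\neq0,\end{cases}$$ where $\mathcal{M}_{k',m'}^0=\{\omega\in\mathcal{M}_{k,m}^*\mid\omega|_{\mathcal{M}_{k',m'}}\equiv0\}$ is the annihilator of $\mathcal{M}_{k',m'}$ in $\mathcal{M}_{k,m}^*$.
   Context: $\mathbb{N}=\{0,1,2,\dots\}$, $\mathbb{N}^*=\{1,2,\dots\}$, and $\mathbb{D}$ is the open unit disc. $\mathcal{E}=\mathbb{C}^{\mathbb{N}^*}$ is the space of complex sequences $\boldsymbol{x}=(x_i)_{i\ge1}$, with the convention $x_0:=0$, and $\boldsymbol 0=(0,0,\dots)$. For $(k,m)\in\mathbb{N}\times\mathbb{N}^*$ define $$\mathcal{M}_{k,m}=\{\boldsymbol{x}\in\mathcal{E}\mid x_{i+m}=x_i\ \text{for all }i\ge k+1,\ \text{and }\beta x_{k+m}-x_k=0\},$$ a complex vector space of dimension $k+m-1$. The map $F_{k,m}\colon\mathcal{M}_{k,m}\to\mathcal{M}_{k,m}$ is defined by: $F_{k,m}(\boldsymbol{x})=\boldsymbol{y}$ if and only if $\beta y_{k+m}-y_k=0$ and $y_i=x_{i-1}^d+y_1$ for all $i\ge2$. (Equivalently $y_1=-x_{m-1}^d$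 if $k=0$, $y_1=-\frac{\beta x_{k+m-1}^d-x_{k-1}^d}{\beta-1}$ if $k\ge1$, and $y_i=x_{i-1}^d+y_1$ for $i\ge2$.) A sequence $\boldsymbol{x}$ is preperiodic of preperiod $k'\ge0$ and period $m'\ge1$ if $x_{i+m'}=x_i$ for all $i\ge k'+1$ and $k',m'$ are the smallest integers with this property. A point $w$ is preperiodic of preperiod $k'$ to a cycle of period $m'$ under $P$ if the sequence $(P^{\circ (i-1)}(w))_{i\ge1}$ has preperiod $k'$ and period $m'$; the multiplier of the cycle is $(P^{\circ m'})'(P^{\circ k'}(w))$. A polynomial is post-critically finite if all its critical points have finite forward orbits. Partial order on $\mathbb{N}\times\mathbb{N}^*$: $(k',m')\preceq(k,m)$ if and only if $m'$ divides $m$, and either $k'=k$, or ($k'=0$ and $m'$ divides $k$). Koch's maps $G_{k,m}\colon\mathbb{C}^{k+m-1}\to\mathbb{C}^{k+m-1}$ (with $x_0:=0$): if $k=0$, the $i$-th coordinate of $G_{0,m}(x_1,\dots,x_{m-1})$ is $x_{i-1}^d-x_{m-1}^d$, $1\le i\le m-1$; if $k\ge1$, the $i$-th coordinate of $G_{k,m}(x_1,\dots,x_{k+m-1})$ is $\left(x_{i-1}-\frac{\beta x_{k+m-1}-x_{k-1}}{\beta-1}\right)^d$, $1\le i\le k+m-1$. The tangent space $T_{\boldsymbol{z}}\mathcal{M}_{k,m}$ is identified with $\mathcal{M}_{k,m}$; $(D_{\boldsymbol{z}}F_{k,m})^*\colon\mathcal{M}_{k,m}^*\to\mathcal{M}_{k,m}^*$,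 $\omega\mapsto\omega\circ D_{\boldsymbol{z}}F_{k,m}$, is the transpose of the derivative. $\operatorname{Spec}$ denotes the set of eigenvalues. *)

(* Defs.v *)
From HB Require Import structures.
From mathcomp Require Import all_boot all_order all_algebra.
From mathcomp Require Import all_classical all_reals all_analysis.
From mathcomp Require Import complex ring.

Set Implicit Arguments.
Unset Strict Implicit.
Unset Printing Implicit Defensive.

Import Order.TTheory GRing.Theory Num.Theory numFieldNormedType.Exports.

Local Open Scope classical_set_scope.
Local Open Scope ring_scope.

Record posnat := PosNat { posnat_val :> nat; posnat_gt0 : (0 < posnat_val)%N }.
HB.instance Definition _ := [isSub for posnat_val].
HB.instance Definition _ := [Equality of posnat by <:].

Definition prec : rel (nat * posnat) := fun p q =>
  (p.2 %| q.2)%N && ((p.1 == q.1) || ((p.1 == 0%N) && (p.2 %| q.1)%N)).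

(* Sequences (x_i)_(i >= 1) are functions on nat; the value at 0 is
   irrelevant in this section. *)
Section Preperiodic.
Variable T : Type.
Implicit Type x : nat -> T.

Definition eventually_periodic x (k m : nat) :=
  forall i, (k < i)%N -> x (i + m)%N = x i.

Definition preperiod_period x (k : nat) (m : posnat) :=
  eventually_periodic x k m /\
  forall (k1 : nat) (m1 : posnat),
    eventually_periodic x k1 m1 -> (k <= k1)%N /\ (m <= m1)%N.

End Preperiodic.

Section Dynamics.
Variable K : comNzRingType.
Implicit Type P : {poly K}.

Definition forward_orbit P (w : K) : set K :=
  [set iter n (horner P) w | n in setT].

Definition critical_values P : set K :=
  [set P.[c] | c in [set c | root P^`() c]].

Definition post_critically_finite P :=
  forall c : K, root P^`() c -> finite_set (forward_orbit P c).

Definition iter_poly P (n : nat) : {poly K} := iter n (comp_poly P) 'X.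

Definition preperiodic_to_cycle P (w : K) (k : nat) (m : posnat) :=
  preperiod_period (fun i => iter i.-1 (horner P) w) k m.

Definition multiplier P (w : K) (k : nat) (m : posnat) : K :=
  (iter_poly P m)^`().[iter k (horner P) w].

End Dynamics.

(* The eigenvalues of T restricted to W, for a T-invariant subspace W. *)
Definition Spec (K : numFieldType) (V : lmodType K) (W : set V) (T : V -> V)
    : set K :=
  [set a | exists v, [/\ W v, v != 0 & T v = a *: v]].

Definition holomorphic (K : numFieldType) (V W : normedModType K)
    (f : V -> W) := forall x, differentiable f x.

Definition holomorphically_conjugate (K : numFieldType) (V W : normedModType K)
    (f : V -> V) (g : W -> W) :=
  exists (phi : V -> W) (psi : W -> V),
    [/\ cancel phi psi, cancel psi phi, holomorphic phi, holomorphic psi &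
        forall x, phi (f x) = g (phi x)].

Section Space.
Variables (R : realType) (beta : R[i]) (k : nat) (m : posnat).

(* The value at 0 of a sequence encodes the convention x_0 := 0. *)
Definition Mset : set (nat -> R[i]^o) :=
  [set x | [/\ x 0%N = 0, eventually_periodic x k m &
               beta * x (k + m)%N - x k = 0]].

Definition Mpred : {pred nat -> R[i]^o} := fun x => x \in Mset.

Lemma MpredP x : reflect (Mset x) (x \in Mpred).
Proof. by apply: (iffP idP); rewrite unfold_in /Mpred inE. Qed.

Lemma Mpred_submod_closed : submod_closed Mpred.
Proof.
split; first by apply/MpredP; split => //; rewrite mulr0 subr0.
move=> a x y /MpredP[x0 xP xb] /MpredP[y0 yP yb]; apply/MpredP.
have E i : (a *: x + y) i = a * x i + y i by [].
split=> [|i ki|]; rewrite !E.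
- by rewrite x0 y0 mulr0 addr0.
- by rewrite xP // yP.
- rewrite (_ : _ - _ = a * (beta * x (k + m)%N - x k)
    + (beta * y (k + m)%N - y k)); last by ring.
  by rewrite xb yb mulr0 addr0.
Qed.

HB.instance Definition _ :=
  GRing.isSubmodClosed.Build R[i] (nat -> R[i]^o) Mpred Mpred_submod_closed.

Record M := MkM { Mseq :> nat -> R[i]^o; MseqP : Mseq \in Mpred }.
HB.instance Definition _ := [isSub for Mseq].
HB.instance Definition _ := [Choice of M by <:].
HB.instance Definition _ := [SubChoice_isSubLmodule of M by <:].

(* The choice of norm is irrelevant, M being finite dimensional. *)
Definition Mnorm (x : M) : R[i] := \sum_(i < (k + m).+1) `|x i|.

Lemma Mnorm_triangle x y : Mnorm (x + y) <= Mnorm x + Mnorm y.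
Proof.
by rewrite /Mnorm -big_split /=; apply: ler_sum => i _; exact: ler_normD.
Qed.

Lemma MnormZ (a : R[i]) x : Mnorm (a *: x) = `|a| * Mnorm x.
Proof. by rewrite /Mnorm mulr_sumr; apply: eq_bigr => i _; exact: normrM. Qed.

Lemma Mnorm_eq0 x : Mnorm x = 0 -> x = 0.
Proof.
move=> /eqP; rewrite /Mnorm psumr_eq0 => [|i _]; last exact: normr_ge0.
move=> /allP x0; apply: val_inj; apply/funext => n /=.
have /MpredP[_ xP _] := MseqP x.
elim/ltn_ind: n => n IH; have [nle|nlt] := ltnP n (k + m).+1.
  have /(_ (mem_index_enum _)) := x0 (Ordinal nle).
  by rewrite /= normr_eq0 => /eqP.
have mn : (m <= n)%N by rewrite (leq_trans _ (ltnW nlt)) // leq_addl.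
rewrite -(subnK mn) xP; last by rewrite ltn_subRL addnC.
apply: IH; rewrite -subn_gt0 subKn //; exact: posnat_gt0.
Qed.

HB.instance Definition _ :=
  Lmodule_isNormed.Build R[i] M Mnorm_triangle MnormZ Mnorm_eq0.

End Space.

Section Maps.
Variables (R : realType) (d : nat) (beta : R[i]).

(* The value at 1 is the unique solution y_1 of beta y_(k+m) = y_k, where
   y_i = x_(i-1)^d + y_1; see Fmap_spec. *)
Definition Fseq (k : nat) (m : posnat) (x : nat -> R[i]) : nat -> R[i]^o :=
  let y1 := if k is k1.+1
    then - ((beta * x (k + m - 1)%N ^+ d - x k1 ^+ d) / (beta - 1))
    else - x (m - 1)%N ^+ d in
  fun i => if i is i1.+1 then (if i1 is 0 then y1 else x i1 ^+ d + y1) else 0.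

Hypotheses (d_ge2 : (2 <= d)%N) (beta_root : beta ^+ d = 1)
  (beta_neq1 : beta != 1).

Lemma FseqS k (m : posnat) (x : nat -> R[i]) j : x 0%N = 0 ->
  Fseq k m x j.+1 = x j ^+ d + Fseq k m x 1%N.
Proof.
by case: j => [|j] // ->; rewrite expr0n eqn0Ngt (ltnW d_ge2) add0r.
Qed.

Lemma Fseq_bdry k (m : posnat) (x : nat -> R[i]) (y1 : R[i]) : x 0%N = 0 ->
  let y i := if i is j.+1 then x j ^+ d + y1 else 0 in
  beta * y (k + m)%N - y k = 0 <-> y1 = Fseq k m x 1%N.
Proof.
move=> x0; have beta_neq0 : beta != 0.
  apply/eqP => b0; move: beta_root; rewrite b0 expr0n eqn0Ngt (ltnW d_ge2).
  by move/esym/eqP; rewrite oner_eq0.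
have betaB : beta - 1 != 0 by rewrite subr_eq0.
case: k => [|k] /=.
  case: m => -[//|m] /= _; rewrite subn1 /= subr0; split=> [/eqP|->].
    by rewrite mulf_eq0 (negPf beta_neq0) /= addrC addr_eq0 => /eqP.
  by rewrite subrr mulr0.
rewrite addSn subn1 /=; set A := x _ ^+ d; set B := x k ^+ d; split=> [E|->].
  have {}E : (beta - 1) * y1 = - (beta * A - B).
    by apply/eqP; rewrite -subr_eq0 -[X in _ == X]E; apply/eqP; ring.
  by rewrite -mulNr -E mulrAC divff // mul1r.
by field.
Qed.

Lemma Fseq_M k m (x : M beta k m) : Fseq k m x \in Mpred beta k m.
Proof.
have /MpredP[x0 xP xb] := MseqP x.
apply/MpredP; split=> // [[//|j]|].
  rewrite ltnS leq_eqVlt addSn (FseqS _ _ (j + m) x0) (FseqS _ _ j x0).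
  move=> /orP[/eqP <-|kj].
    congr (_ + _); move/eqP: xb; rewrite subr_eq0 => /eqP <-.
    by rewrite exprMn beta_root mul1r.
  by rewrite xP.
have /(_ (Fseq k m x 1%N))[_ /(_ erefl)] := Fseq_bdry k m _ x0.
have E i : (if i is j.+1 then x j ^+ d + Fseq k m x 1%N else 0) = Fseq k m x i.
  by case: i => // j; rewrite (FseqS _ _ j x0).
by rewrite !E.
Qed.

Definition Fmap k m (x : M beta k m) : M beta k m := MkM (Fseq_M x).

Lemma Fmap_spec k m (x y : M beta k m) :
  Fmap x = y <->
  beta * y (k + m)%N - y k = 0 /\
  forall i, (2 <= i)%N -> y i = x (i - 1)%N ^+ d + y 1%N.
Proof.
have /MpredP[x0 _ _] := MseqP x.
split=> [<-|[yb yS]].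
  split; first by have /MpredP[] := Fseq_M x.
  by case=> [|j _] //; rewrite subn1; exact: (FseqS k m j x0).
have /MpredP[y0 _ _] := MseqP y.
have E i : y i = if i is j.+1 then x j ^+ d + y 1%N else 0.
  case: i => [|[|j]] //; first by rewrite x0 expr0n eqn0Ngt (ltnW d_ge2) add0r.
  by rewrite yS // subn1.
have y1 : y 1%N = Fseq k m x 1%N.
  by have /(_ (y 1%N))[H _] := Fseq_bdry k m _ x0; apply: H; rewrite -!E.
apply: val_inj; apply/funext => -[|j] /=; first by rewrite y0.
by rewrite -[LHS]/(Fseq k m x j.+1) (FseqS _ _ j x0) E y1.
Qed.

End Maps.

Arguments Fmap {R d beta} d_ge2 beta_root beta_neq1 k m x.

Section Koch.
Variables (R : realType) (d : nat) (beta : R[i]) (k : nat) (m : posnat).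

(* The coordinate x_i of x = (x_1, ..., x_n), with x_0 := 0. *)
Definition entry n (x : 'rV[R[i]]_n) (i : nat) : R[i] :=
  if i is j.+1 then (if insub j is Some o then x 0 o else 0) else 0.

(* The column of index i : 'I_n holds the coordinate number i + 1. *)
Definition Gmap (x : 'rV[R[i]]_(k + m - 1)) : 'rV[R[i]]_(k + m - 1) :=
  \row_(i < k + m - 1)
    if k is k1.+1
    then (entry x i
          - (beta * entry x (k + m - 1) - entry x k1) / (beta - 1)) ^+ d
    else entry x i ^+ d - entry x (m - 1) ^+ d.

End Koch.

Arguments Gmap {R} d beta k m x.

(* Linear forms, as functions valued in the one-dimensional module R[i]^o. *)
Definition annihilator (R : realType) (beta : R[i]) (k : nat) (m : posnat)
    (k' : nat) (m' : posnat) : set (M beta k m -> R[i]^o) :=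
  [set om | linear om /\ forall x : M beta k m, Mset beta k' m' x -> om x = 0].

Definition transpose (R : realType) (V : lmodType R[i]) (T : V -> V)
    (om : V -> R[i]^o) : V -> R[i]^o := om \o T.

(* Main.v *)
(* Differentiating F at z gives (DF v)_(j+1) = d z_j^(d-1) v_j + (DF v)_1.

   Part (4), the eigenvalues mu on M_(k',m'), needs no quadratic differentials.
   First, |mu| >= 1: an eigenvector v is an infinitesimal motion z_i + t v_i of
   the critical orbit, which for t in a fixed square extends to a holomorphic
   motion h.  The equation h'(a)^d = h(P a) - h(c) lifts h to a new motion over
   the same square, with velocity divided by mu and with the same bound
   |h'| <= M as soon as M^d >= 2 M.  Iterating, mu^-n v stays bounded by Cauchy's
   estimate.  Second, |mu| <> 1: the characteristic equation makes mu an algebraic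
   integer and gives 2 mu^N = d tau (mu^N = 2 tau if d = 2) with tau an algebraic
   integer.  If |mu| = 1 then 1/mu = conj mu is integral too, so that 2/d (or 1/2)
   would be an algebraic integer.

   Part (5) follows from the action of DF on M_(k,m) / M_(k',m').  If k' = 0 it is
   nilpotent; otherwise the defect v_(i+m') - v_i of m'-periodicity is a
   coordinate system on the quotient, on which DF acts as a cyclic shift with
   weights d z_i^(d-1), whose product over a period is lambda. *)

From HB Require Import structures.
Require Import Defs.
From mathcomp Require Import all_boot all_order all_algebra.
From mathcomp Require Import all_classical all_reals all_analysis.
From mathcomp Require Import complex ring lra zify.

Set Implicit Arguments.
Unset Strict Implicit.
Unset Printing Implicit Defensive.

Import Order.TTheory GRing.Theory Num.Theory numFieldNormedType.Exports.

Local Open Scope classical_set_scope.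
Local Open Scope ring_scope.

(** * Algebraic integers *)

(** In (4) the domain of the motions must not shrink under lifting, since Cauchy's estimate divides
    by its size. This is why motions carry non-collision: it makes [h (P a) - h c] zero-free for
    nonzero [a], so that a root exists over the whole square, and the lift inherits it. Holomorphy
    is encoded as polynomial approximation to every order at every point of the closed square. This
    passes to continuous roots and to difference quotients, and order three already yields the
    maximum principle behind Cauchy's estimate.

    The factor 2 in the arithmetic comes from dividing the boundary condition by beta - 1: it
    becomes mu^n = -(d / (beta - 1)) u with u integral, and twice the square of d / (beta - 1) is d
    times an algebraic integer. For d = 2 that factor is -1 and says nothing; a computation modulo 2
    replaces it.

    In (5) the values with mu^m' = lambda are missing because defects are constrained: v_(i+m') -
    v_i, summed along steps of m' through one period m, gives zero. *)

Section AlgebraicIntegers.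
Variable C : numClosedFieldType.
Implicit Types (x y : C) (p q : {poly C}).

Definition algint x := integralOver (intr : int -> C) x.
Definition algint_poly p := forall i, algint p`_i.

Lemma algint_nat n : algint n%:R. Proof. exact: integral_nat. Qed.
Lemma algintN x : algint x -> algint (- x). Proof. exact: integral_opp. Qed.
Lemma algintD x y : algint x -> algint y -> algint (x + y).
Proof. exact: integral_add. Qed.
Lemma algintB x y : algint x -> algint y -> algint (x - y).
Proof. exact: integral_sub. Qed.
Lemma algintM x y : algint x -> algint y -> algint (x * y).
Proof. exact: integral_mul. Qed.
Lemma algintX x n : algint x -> algint (x ^+ n).
Proof.
by move=> xZ; elim: n => [|n IH]; [exact: integral1 | rewrite exprS; exact: algintM].
Qed.
Lemma algint_sum n (f : nat -> C) :
  (forall i, algint (f i)) -> algint (\sum_(i < n) f i).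
Proof.
by move=> fZ; elim/big_ind: _ => //; [exact: (algint_nat 0) | exact: algintD].
Qed.

Lemma algint_conj x : algint x -> algint (Num.conj x).
Proof.
case=> p p_monic /rootP px; exists p => //; apply/rootP.
have -> : map_poly intr p = map_poly (Num.conj : C -> C) (map_poly intr p).
  by apply/polyP => i; rewrite !coef_map /= rmorph_int.
by rewrite horner_map px rmorph0.
Qed.

Lemma algint_polyP p : algint_poly p <-> {in p : seq C, integralRange intr}.
Proof. exact: integral_poly. Qed.

Lemma algint_polyZ a p : algint a -> algint_poly p -> algint_poly (a *: p).
Proof. by move=> aZ pZ i; rewrite coefZ; exact: algintM. Qed.

Lemma algint_polyD p q : algint_poly p -> algint_poly q -> algint_poly (p + q).
Proof. by move=> pZ qZ i; rewrite coefD; exact: algintD. Qed.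

Lemma algint_polyB p q : algint_poly p -> algint_poly q -> algint_poly (p - q).
Proof. by move=> pZ qZ i; rewrite coefB; exact: algintB. Qed.

Lemma algint_polyM p q : algint_poly p -> algint_poly q -> algint_poly (p * q).
Proof.
move=> pZ qZ i; rewrite coefM.
by apply: (@algint_sum i.+1 (fun j => p`_j * q`_(i - j))) => j; exact: algintM.
Qed.

Lemma algint_polyXn n : algint_poly 'X^n.
Proof. by move=> i; rewrite coefXn; exact: algint_nat. Qed.

Lemma algint_poly_exp p n : algint_poly p -> algint_poly (p ^+ n).
Proof.
move=> pZ; elim: n => [|n IH]; first exact: (@algint_polyXn 0).
by rewrite exprS; exact: algint_polyM.
Qed.

Lemma algint_horner p x : algint_poly p -> algint x -> algint p.[x].
Proof. by move=> /algint_polyP; exact: integral_horner. Qed.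

Lemma algint_root_monic n p x : (size p <= n)%N -> algint_poly p ->
  x ^+ n + p.[x] = 0 -> algint x.
Proof.
move=> p_size pZ xE; apply: (@integral_root_monic _ _ _ x ('X^n + p)).
- by rewrite monicE lead_coefDl ?lead_coefXn // size_polyXn.
- by rewrite rootE hornerD hornerXn xE.
- by apply/algint_polyP/algint_polyD => //; exact: algint_polyXn.
Qed.

(** Rational root theorem: with a / b = a' / b' in lowest terms, clearing denominators in the monic
    equation makes b' divide a' ^ n, so b' = 1. *)
Lemma algint_ratio (a b : nat) : (0 < b)%N -> algint (a%:R / b%:R) -> (b %| a)%N.
Proof.
move=> b_gt0 [p p_monic /rootP pab].
set g := gcdn a b; have g_gt0 : (0 < g)%N by rewrite gcdn_gt0 b_gt0 orbT.
have [a' aE] : exists a', a = (a' * g)%N.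
  by exists (a %/ g)%N; rewrite divnK // dvdn_gcdl.
have [b' bE] : exists b', b = (b' * g)%N.
  by exists (b %/ g)%N; rewrite divnK // dvdn_gcdr.
have b'_gt0 : (0 < b')%N by move: b_gt0; rewrite bE muln_gt0 => /andP[].
have cop : coprime b' a'.
  have : gcdn (b' * g) (a' * g) = g by rewrite -aE -bE gcdnC.
  rewrite -muln_gcdl => /eqP; rewrite -[X in _ == X]mul1n eqn_pmul2r //.
have abE : a%:R / b%:R = a'%:R / b'%:R :> C.
  rewrite aE bE !natrM -mulf_div divff ?mulr1 // pnatr_eq0 -lt0n //.
have b'0 : b'%:R != 0 :> C by rewrite pnatr_eq0 -lt0n.
pose n := (size p).-1.
have sp : size (map_poly (intr : int -> C) p) = n.+1.
  rewrite size_map_inj_poly ?rmorph0 //; last exact: intr_inj.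
  by rewrite prednK // lt0n size_poly_eq0 monic_neq0.
(* The non-leading terms of the equation after multiplication by b' ^ n, with one factor b' taken
   out. *)
pose S : int := \sum_(i < n) p`_i * (a'%:Z ^+ i * b'%:Z ^+ (n - i.+1)).
have SE : a'%:Z ^+ n = - (b'%:Z * S).
  apply: (@intr_inj C); move: pab; rewrite horner_coef sp big_ord_recr /=.
  have -> : (map_poly (intr : int -> C) p)`_n = 1.
    by rewrite coef_map /= [p`_n](monicP p_monic).
  move/(congr1 ( *%R (b'%:R ^+ n))); rewrite mulr0 mulrDr mul1r abE expr_div_n.
  rewrite [_ ^+ n * (_ / _)]mulrC divfK ?expf_neq0 //.
  move/eqP; rewrite addrC addr_eq0 => /eqP.
  rewrite rmorphXn rmorphN rmorphM /= => ->.
  rewrite /S rmorph_sum /= !mulr_sumr; congr (- _); apply: eq_bigr => i _.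
  rewrite coef_map /= !rmorphM !rmorphXn /= expr_div_n.
  have -> : b'%:R ^+ n = b'%:R * b'%:R ^+ (n - i.+1) * b'%:R ^+ i :> C.
    by rewrite -exprS -exprD; congr (_ ^+ _); have := ltn_ord i; lia.
  by field; rewrite ?expf_neq0.
have : (b' %| a' ^ n)%N.
  have : (b'%:Z %| a'%:Z ^+ n)%Z by rewrite SE -mulrN dvdz_mulr.
  by rewrite dvdzE abszX.
rewrite -[(_ ^ _)%N]mul1n Gauss_dvdl ?dvdn1 ?coprimeXr // => /eqP b'1.
by rewrite bE b'1 mul1n aE dvdn_mull.
Qed.

(* On the unit circle the inverse is the conjugate, which is again integral. *)
Lemma algint_unimodular_dvdn (a b n : nat) mu tau : (0 < b)%N ->
  algint mu -> `|mu| = 1 -> algint tau -> a%:R * mu ^+ n = b%:R * tau ->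
  (b %| a)%N.
Proof.
move=> b_gt0 muZ mu1 tauZ E; apply: algint_ratio => //.
have b0 : b%:R != 0 :> C by rewrite pnatr_eq0 -lt0n.
suff -> : a%:R / b%:R = tau * Num.conj mu ^+ n.
  by apply: algintM => //; apply: algintX; exact: algint_conj.
have mumu : mu ^+ n * Num.conj mu ^+ n = 1.
  by rewrite -exprMn -normCK mu1 !expr1n.
apply: (mulfI b0); rewrite mulrCA divff // mulr1 mulrA -E -mulrA mumu mulr1 //.
Qed.

Section RootOfUnity.
Variables (d : nat) (beta : C).
Hypotheses (d_ge2 : (2 <= d)%N) (beta_root : beta ^+ d = 1) (beta_neq1 : beta != 1).

Let s j := \sum_(i < j) beta ^+ i.

Let sE j : beta ^+ j - 1 = (beta - 1) * s j.
Proof. exact: subrX1. Qed.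

Let beta1 : beta - 1 != 0. Proof. by rewrite subr_eq0. Qed.

Lemma algint_unity_root : algint beta.
Proof.
apply: (@algint_root_monic d (- 1)).
- by rewrite size_polyN size_poly1 ltnW.
- by move=> i; rewrite coefN coef1; apply: algintN; exact: algint_nat.
- by rewrite hornerN hornerC beta_root subrr.
Qed.

Let sZ j : algint (s j).
Proof. by apply: algint_sum => i; apply: algintX; exact: algint_unity_root. Qed.

Let sum_unity_root : \sum_(j < d) beta ^+ j = 0.
Proof. by apply: (mulfI beta1); rewrite mulr0 -subrX1 beta_root subrr. Qed.

(** (beta - 1) times the sum of the [s j] is the sum of beta ^ j - 1 over j < d, which is -d because
    the powers of beta sum to zero. *)
Lemma algint_divr_unity_root : algint (d%:R / (beta - 1)).
Proof.
suff -> : d%:R / (beta - 1) = - \sum_(j < d) s j.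
  by apply: algintN; exact: algint_sum.
apply: (mulIf beta1); rewrite divfK // mulNr mulr_suml.
under eq_bigr do rewrite mulrC -sE.
by rewrite sumrB sum_unity_root sumr_const card_ord sub0r opprK.
Qed.

(* Sum over j of (1 - beta^j)(1 - beta^-j) = 2 - beta^j - beta^-j. *)
Lemma algint_sqr_divr_unity_root : exists2 e : C, algint e &
  2%:R * (d%:R / (beta - 1)) ^+ 2 = d%:R * e.
Proof.
exists (- \sum_(j < d) beta ^+ (d - j) * s j ^+ 2).
  apply: algintN; apply: (@algint_sum d (fun j => beta ^+ (d - j) * s j ^+ 2)).
  by move=> j; apply: algintM; apply: algintX => //; exact: algint_unity_root.
have E : (beta - 1) ^+ 2 * (\sum_(j < d) beta ^+ (d - j) * s j ^+ 2) = - (2%:R * d%:R).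
  rewrite mulr_sumr.
  transitivity (\sum_(j < d) (beta ^+ (d - j) + beta ^+ j - 2%:R)).
    apply: eq_bigr => j _; rewrite mulrCA -exprMn -sE.
    have bb : beta ^+ (d - j) * beta ^+ j = 1.
      by rewrite -exprD subnK // ltnW.
    transitivity (beta ^+ (d - j) * beta ^+ j * beta ^+ j
      - 2%:R * (beta ^+ (d - j) * beta ^+ j) + beta ^+ (d - j)); first by ring.
    by rewrite bb; ring.
  rewrite sumrB big_split /= sum_unity_root addr0 sumr_const card_ord.
  rewrite (_ : \sum_(i < d) _ = 0) ?sub0r ?mulr_natr //.
  transitivity (beta * \sum_(j < d) beta ^+ j).
    rewrite (reindex_inj rev_ord_inj) /= mulr_sumr.
    apply: eq_bigr => j _.
    by rewrite -exprS; congr (_ ^+ _); have := ltn_ord j; lia.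
  by rewrite sum_unity_root mulr0.
have beta12 : (beta - 1) ^+ 2 != 0 by rewrite expf_neq0.
apply: (mulfI beta12).
rewrite [RHS](_ : _ = d%:R * - ((beta - 1) ^+ 2 * \sum_(j < d) beta ^+ (d - j) * s j ^+ 2)).
  by rewrite E; field.
by ring.
Qed.
End RootOfUnity.
End AlgebraicIntegers.

(** * Arithmetic of the characteristic equation: no eigenvalue of modulus one *)

Section Unimodular.
Variables (C : numClosedFieldType) (d : nat) (z v : nat -> C) (mu : C).
Hypotheses (d_ge2 : (2 <= d)%N) (z0 : z 0%N = 0)
  (zS : forall i, z i.+1 = z i ^+ d + z 1%N).
Hypotheses (v1 : v 1%N != 0)
  (vS : forall i, mu * v i.+1 = d%:R * z i ^+ d.-1 * v i + mu * v 1%N).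

(** [Q n] is the n-th point of the critical orbit as a polynomial in the parameter. For n > 0 it is
    monic of degree d ^ (n - 1), so a coincidence in the orbit is a monic integral equation for
    z_1. *)
Lemma algint_param (i j : nat) : (i < j)%N -> z i.+1 = z j.+1 -> algint (z 1%N).
Proof.
move=> ij zij; pose Q := fix Q n : {poly C} := if n is n'.+1 then Q n' ^+ d + 'X else 0.
have QZ n : algint_poly (Q n).
  elim: n => [|n IH] /=; first by move=> t; rewrite coef0; exact: (algint_nat _ 0).
  by apply: algint_polyD; [exact: algint_poly_exp | exact: (@algint_polyXn _ 1)].
have Qz n : (Q n).[z 1%N] = z n.
  elim: n => [|n IH] /=; first by rewrite horner0.
  by rewrite hornerD horner_exp hornerX IH -zS.
have d_gt0 : (0 < d)%N by exact: ltnW.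
have Q_size n : size (Q n.+1) = (d ^ n).+1 /\ Q n.+1 \is monic.
  elim: n => [|n [sQ mQ]].
    rewrite [Q 1%N]/= expr0n eqn0Ngt d_gt0 add0r size_polyX; split => //.
    exact: monicX.
  have mX : Q n.+1 ^+ d \is monic by exact: monic_exp.
  have sX : size (Q n.+1 ^+ d) = (d ^ n.+1).+1.
    rewrite -(prednK (_ : (0 < size (Q n.+1 ^+ d))%N)) ?size_exp ?sQ ?expnSr //.
    by rewrite lt0n size_poly_eq0 monic_neq0.
  have sX2 : (size ('X : {poly C}) < size (Q n.+1 ^+ d))%N.
    by rewrite size_polyX sX ltnS (leq_trans d_ge2) // -[X in (X <= _)%N]expn1 leq_exp2l.
  rewrite [Q n.+2]/= -/(Q n.+1) size_polyDl // sX; split => //.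
  by rewrite monicE lead_coefDl.
have [sj mj] := Q_size j; have [si mi] := Q_size i.
have sij : (size (Q i.+1) < size (Q j.+1))%N by rewrite si sj ltnS ltn_exp2l.
apply: (@integral_root_monic _ _ _ _ (Q j.+1 - Q i.+1)).
- by rewrite monicE lead_coefDl ?size_polyN // -monicE.
- by rewrite rootE hornerD hornerN !Qz zij subrr.
- by apply/algint_polyP/algint_polyB.
Qed.

Hypothesis z1Z : algint (z 1%N).

Lemma algint_orbit i : algint (z i).
Proof.
elim: i => [|i IH]; first by rewrite z0; exact: (algint_nat _ 0).
by rewrite zS; apply: algintD => //; exact: algintX.
Qed.

(* T n.+1 is the polynomial with value mu ^+ n * v n.+1 / v 1 at mu. *)
Let T := fix T n : {poly C} :=
  if n is n'.+1 then 'X^n' + (d%:R * z n' ^+ d.-1) *: T n' else 0.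

Let TS n : T n.+1 = 'X^n + (d%:R * z n ^+ d.-1) *: T n. Proof. by []. Qed.

Let T_horner n : (T n.+1).[mu] * v 1%N = mu ^+ n * v n.+1.
Proof.
elim: n => [|n IH].
  by rewrite TS /= scaler0 addr0 hornerXn.
rewrite TS hornerD hornerXn hornerZ mulrDl -mulrA IH exprSr -!mulrA vS.
by ring.
Qed.

Let T_algint n : algint_poly (T n).
Proof.
elim: n => [|n IH]; first by move=> i; rewrite coef0; exact: (algint_nat _ 0).
apply: algint_polyD; first exact: algint_polyXn.
apply: algint_polyZ => //; apply: algintM; first exact: algint_nat.
by apply: algintX; exact: algint_orbit.
Qed.

Let T_size n : (size (T n) <= n)%N.
Proof.
elim: n => [|n IH]; first by rewrite size_poly0.
rewrite TS (leq_trans (size_polyD _ _)) // geq_max size_polyXn leqnn.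
by rewrite (leq_trans (size_scale_leq _ _)) // (leq_trans IH).
Qed.

(** The condition v_m = 0 is the characteristic equation: mu ^ (m - 1) is d times an integral
    element, so |mu| = 1 would make d divide 1. *)
Lemma eigenvalue_not_unimodular_periodic (m : nat) :
  (0 < m)%N -> v m = 0 -> `|mu| != 1.
Proof.
case: m => // m _ vm0; apply/eqP => mu1.
have E : mu ^+ m + d%:R * (z m ^+ d.-1 *: T m).[mu] = 0.
  apply: (mulIf v1); rewrite mul0r -[RHS](mulr0 (mu ^+ m)) -vm0 -T_horner.
  by rewrite TS hornerD hornerXn !hornerZ mulrA.
have zT : algint_poly (z m ^+ d.-1 *: T m).
  by apply: algint_polyZ => //; apply: algintX; exact: algint_orbit.
have muZ : algint mu.
  apply: (@algint_root_monic _ m (d%:R *: (z m ^+ d.-1 *: T m))).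
  - by rewrite scalerA (leq_trans (size_scale_leq _ _)).
  - by apply: algint_polyZ => //; exact: algint_nat.
  - by rewrite hornerZ.
have : (d %| 1)%N.
  apply: (@algint_unimodular_dvdn _ 1 d m mu (- (z m ^+ d.-1 *: T m).[mu])) => //.
  - exact: ltnW.
  - by apply: algintN; exact: algint_horner.
  - by rewrite mul1r mulrN; apply/eqP; rewrite -addr_eq0 E.
by rewrite dvdn1; case: d d_ge2 => [|[]].
Qed.

Variable beta : C.
Hypotheses (beta_root : beta ^+ d = 1) (beta_neq1 : beta != 1).

Lemma eigenvalue_not_unimodular_preperiodic (k m : nat) : (0 < m)%N ->
  z k.+1 = beta * z (k.+1 + m)%N -> v k.+1 = beta * v (k.+1 + m)%N -> `|mu| != 1.
Proof.
move=> m_gt0 zb vb; apply/eqP => mu1.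
have beta1 : beta - 1 != 0 by rewrite subr_eq0.
have bZ : algint beta by exact: algint_unity_root beta_root.
set n := (k + m)%N.
(* In beta T_(n+1) - X^m T_(k+1) the leading monomials combine into (beta - 1) X^n; [U] gathers the
   rest, a factor d being taken out. *)
pose U := (beta * z n ^+ d.-1) *: T n - z k ^+ d.-1 *: ('X^m * T k).
have UZ : algint_poly U.
  apply: algint_polyB; apply: algint_polyZ.
  - by apply: algintM => //; apply: algintX; exact: algint_orbit.
  - exact: T_algint.
  - by apply: algintX; exact: algint_orbit.
  - by apply: algint_polyM; [exact: algint_polyXn | exact: T_algint].
have Usize : (size U <= n)%N.
  rewrite (leq_trans (size_polyD _ _)) // geq_max.
  rewrite (leq_trans (size_scale_leq _ _)) //= size_polyN.
  rewrite (leq_trans (size_scale_leq _ _)) //.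
  rewrite (leq_trans (size_polyMleq _ _)) // size_polyXn /= /n addnC leq_add2r //.
have E : mu ^+ n = - (d%:R / (beta - 1) * U.[mu]).
  have E1 : beta * (T n.+1).[mu] = mu ^+ m * (T k.+1).[mu].
    apply: (mulIf v1); rewrite -!mulrA !T_horner vb /n -addSn exprD.
    by ring.
  rewrite !TS !hornerD !hornerXn !hornerZ in E1.
  have {}E1 : (beta - 1) * mu ^+ n + d%:R * U.[mu] = 0.
    rewrite /U hornerD hornerN !hornerZ hornerM hornerXn.
    move/eqP: E1; rewrite -subr_eq0 => /eqP <-; rewrite /n exprD; ring.
  have {}E1 : (beta - 1) * mu ^+ n = - (d%:R * U.[mu]).
    by apply/eqP; rewrite -addr_eq0 E1.
  by rewrite -[LHS](mulKf beta1) E1; field.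
have aZ := algint_divr_unity_root d_ge2 beta_root beta_neq1.
have muZ : algint mu.
  apply: (@algint_root_monic _ n ((d%:R / (beta - 1)) *: U)).
  - by rewrite (leq_trans (size_scale_leq _ _)).
  - exact: algint_polyZ.
  - by rewrite hornerZ E addNr.
have UmuZ : algint U.[mu] by exact: algint_horner.
have [d2|d3] : d = 2%N \/ (2 < d)%N by move: d_ge2; lia.
(* Here d / (beta - 1) = -1. Modulo 2 the equation becomes mu ^ n = - s mu ^ (n - 1); applying it
   twice gives s ^ 2 mu ^ (n - 1) for mu ^ (n + 1), and s ^ 2 is even. *)
- have beta2 : beta ^+ 2 = 1 by rewrite -d2.
  have bN1 : beta = -1.
    apply/eqP; rewrite -addr_eq0; move/eqP: beta2.
    by rewrite -subr_eq0 subr_sqr_1 mulf_eq0 (negPf beta1).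
  have TE p : (0 < p)%N -> exists2 tau, algint tau & (T p).[mu] = mu ^+ p.-1 + 2%:R * tau.
    case: p => // p _; exists (z p * (T p).[mu]).
      by apply: algintM; [exact: algint_orbit | exact: algint_horner].
    by rewrite TS hornerD hornerXn hornerZ d2 /= mulrA.
  have n_gt0 : (0 < n)%N by rewrite addn_gt0 m_gt0 orbT.
  have [t1 t1Z t1E] : exists2 tau, algint tau &
      z k * (mu ^+ m * (T k).[mu]) = z k * mu ^+ n.-1 + 2%:R * tau.
    (* [T 0] is 0 and escapes [TE], but then the factor z_0 vanishes too; this is why z_k is kept in
       the claim. *)
    have [->|k_gt0] := posnP k.
      by exists 0; [exact: (algint_nat _ 0) | rewrite z0; ring].
    have [t tZ ->] := TE _ k_gt0; exists (z k * (mu ^+ m * t)).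
      by apply: algintM; [exact: algint_orbit | apply: algintM => //; exact: algintX].
    have -> : n.-1 = (m + k.-1)%N by rewrite /n; lia.
    by rewrite exprD; ring.
  have [t2 t2Z t2E] := TE _ n_gt0.
  pose s := z n + z k; pose t := t1 + z n * t2.
  have sZ : algint s by apply: algintD; exact: algint_orbit.
  have tZ : algint t by apply: algintD => //; apply: algintM => //; exact: algint_orbit.
  have muE : mu ^+ n = - s * mu ^+ n.-1 - 2%:R * t.
    have -> : 2%:R * t = z k * (mu ^+ m * (T k).[mu]) - z k * mu ^+ n.-1
       + z n * ((T n).[mu] - mu ^+ n.-1) by rewrite t1E t2E /t; ring.
    rewrite E /U hornerD hornerN !hornerZ hornerM hornerXn d2 bN1 /s -[2.-1]/1%N !expr1.
    by field.
  (* By z_(k+1) = - z_(n+1), the squares of z_k and z_n add up to -2 z_1. *)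
  have sE : s ^+ 2 = 2%:R * (z k * z n - z 1%N).
    have : z k ^+ 2 + z 1%N = - (z n ^+ 2 + z 1%N).
      by rewrite -{1}d2 -zS zb bN1 addSn zS d2 mulN1r.
    move/eqP; rewrite -subr_eq0 => /eqP h; apply/eqP; rewrite -subr_eq0 -h /s.
    by apply/eqP; ring.
  have : (2 %| 1)%N => //.
  apply: (@algint_unimodular_dvdn _ 1 2 n.+1 mu
    ((z k * z n - z 1%N) * mu ^+ n.-1 + t * (s - mu))) => //.
  + apply: algintD; apply: algintM => //; [|exact: algintX|exact: algintB].
    by apply: algintB => //; apply: algintM; exact: algint_orbit.
  + have -> : 2%:R * ((z k * z n - z 1%N) * mu ^+ n.-1 + t * (s - mu))
      = s ^+ 2 * mu ^+ n.-1 + 2%:R * t * (s - mu) by rewrite sE; ring.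
    have muE2 : mu ^+ n = mu * mu ^+ n.-1 by rewrite -exprS prednK.
    rewrite mul1r exprS; transitivity (- s * (mu * mu ^+ n.-1) - 2%:R * t * mu).
      by rewrite muE; ring.
    by rewrite -muE2 muE; ring.
(* Squaring the equation brings in 2 (d / (beta - 1)) ^ 2 = d e, so that |mu| = 1 would make d
   divide 2. *)
- have [e eZ eE] := algint_sqr_divr_unity_root d_ge2 beta_root beta_neq1.
  have : (d %| 2)%N.
    apply: (@algint_unimodular_dvdn _ 2 d (n * 2) mu (e * U.[mu] ^+ 2)) => //.
    + exact: ltnW.
    + by apply: algintM => //; exact: algintX.
    + by rewrite exprM E sqrrN exprMn [LHS]mulrA eE mulrA.
  by move=> /dvdn_leq => /(_ isT); rewrite leqNgt d3.
Qed.
End Unimodular.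

(** * Local polynomial approximation *)

Section Convergence.
Variables (C : numFieldType) (T : Type) (F : set_system T).
Context {FF : Filter F}.

Lemma cvg_exp (f : T -> C) (a : C) n : f @ F --> a -> f x ^+ n @[x --> F] --> a ^+ n.
Proof.
move=> fa; elim: n => [|n IH]; first exact: cvg_cst.
by rewrite exprS; under eq_fun do rewrite exprS; exact: cvgM.
Qed.

Lemma cvg_sum_ord n (f : 'I_n -> T -> C) (a : 'I_n -> C) : (forall i, f i @ F --> a i) ->
  \sum_(i < n) f i x @[x --> F] --> \sum_(i < n) a i.
Proof.
elim: n f a => [|n IH] f a fa.
  by rewrite big_ord0; under eq_fun do rewrite big_ord0; exact: cvg_cst.
rewrite big_ord_recr; under eq_fun do rewrite big_ord_recr /=.
by apply: cvgD; [exact: IH | exact: fa].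
Qed.

Lemma cvg_prod_ord n (f : 'I_n -> T -> C) (a : 'I_n -> C) : (forall i, f i @ F --> a i) ->
  \prod_(i < n) f i x @[x --> F] --> \prod_(i < n) a i.
Proof.
elim: n f a => [|n IH] f a fa.
  by rewrite big_ord0; under eq_fun do rewrite big_ord0; exact: cvg_cst.
rewrite big_ord_recr; under eq_fun do rewrite big_ord_recr /=.
by apply: cvgM; [exact: IH | exact: fa].
Qed.

Lemma cvg_horner (p : {poly C}) (f : T -> C) (a : C) :
  f @ F --> a -> p.[f x] @[x --> F] --> p.[a].
Proof.
move=> fa; rewrite horner_coef; under eq_fun do rewrite horner_coef.
by apply: cvg_sum_ord => i; apply: cvgM; [exact: cvg_cst | exact: cvg_exp].
Qed.

(** The sum is the cofactor of s - t in s ^ d - t ^ d. For nonzero b its limit is nonzero, which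
    converts estimates on d-th powers into estimates on roots. *)
Lemma cvg_subrXX_cofactor d (s t : T -> C) (b : C) : s @ F --> b -> t @ F --> b ->
  \sum_(i < d) s x ^+ (d.-1 - i) * t x ^+ i @[x --> F] --> d%:R * b ^+ d.-1.
Proof.
move=> sb tb.
have -> : d%:R * b ^+ d.-1 = \sum_(i < d) b ^+ (d.-1 - i) * b ^+ i.
  rewrite (eq_bigr (fun _ => b ^+ d.-1)) => [|i _].
    by rewrite sumr_const card_ord mulr_natl.
  by rewrite -exprD subnK //; case: d i => [[]|n i] //=; rewrite -ltnS.
apply: cvg_sum_ord => i.
by apply: cvgM; exact: cvg_exp.
Qed.

Lemma near_norm_ge_half (f : T -> C) (a : C) : f @ F --> a -> a != 0 ->
  \forall x \near F, `|a| / 2 <= `|f x|.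
Proof.
move=> /cvgrPdist_le fa a0.
have a2 : 0 < `|a| / 2 by rewrite divr_gt0 // normr_gt0.
near=> x; have : `|a - f x| <= `|a| / 2 by near: x; exact: fa.
move=> H; have := ler_distD 0 a (f x); rewrite !subr0 sub0r normrN => H2.
have := ler_normD (a - f x) (f x); rewrite subrK => H3.
rewrite -(lerD2l (`|a| / 2)) -splitr (le_trans H3) //.
by rewrite lerD2r.
Unshelve. all: by end_near.
Qed.
End Convergence.

(** * Polynomial approximation relative to a set *)

Section Jets.
Variables (C : numFieldType) (K : set C).
Implicit Types (f g : C -> C) (a : C) (p q : {poly C}).

Local Notation at_ a := (within K (nbhs a)).

(** An expansion in the variable x - a, tested only along [K] so that boundary points of [K] are
    allowed. *)
Definition jet n f a p :=
  exists B, \forall x \near at_ a, `|f x - p.[x - a]| <= B * `|x - a| ^+ n.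

(* A substitute for analyticity that is closed under extracting roots and
   under division. *)
Definition smooth f := forall a, K a -> forall n, exists p, jet n f a p.

Lemma near_interior a (P : set C) : nbhs a K ->
  (\forall x \near at_ a, P x) -> \forall x \near a, P x.
Proof. by move=> Ka; rewrite near_withinE; apply: filterS2 Ka => x Kx; exact. Qed.

Lemma at_cvg a : x @[x --> at_ a] --> a.
Proof. exact: cvg_within. Qed.

Lemma at_cvg0 a : x - a @[x --> at_ a] --> (0 : C).
Proof.
rewrite -[X in _ --> X](subrr a); apply: cvgB; [exact: at_cvg | exact: cvg_cst].
Qed.

Lemma horner_near_bounded p a :
  \forall x \near at_ a, `|p.[x - a]| <= `|p.[0]| + 1.
Proof.
have /cvgr_norm_le : p.[x - a] @[x --> at_ a] --> p.[0] by apply: cvg_horner; exact: at_cvg0.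
by apply; rewrite ltrDl.
Qed.

Lemma jet_center n f a p : K a -> (0 < n)%N -> jet n f a p -> f a = p.[0].
Proof.
move=> Ka n0 [B] /nbhs_singleton /(_ Ka).
rewrite subrr normr0 expr0n eqn0Ngt n0 mulr0 normr_le0 subr_eq0 => /eqP //.
Qed.

Lemma jet_cvg n f a p : (0 < n)%N -> jet n f a p -> f @ at_ a --> p.[0].
Proof.
move=> n0 [B fp].
have pa : p.[x - a] @[x --> at_ a] --> p.[0] by apply: cvg_horner; exact: at_cvg0.
have Ba : B * `|x - a| ^+ n @[x --> at_ a] --> (0 : C).
  rewrite -[X in _ --> X](mulr0 B); apply: cvgM; first exact: cvg_cst.
  have -> : (0 : C) = `|0 : C| ^+ n by rewrite normr0 expr0n eqn0Ngt n0.
  by apply: cvg_exp; apply: cvg_norm; exact: at_cvg0.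
have : f x - p.[x - a] @[x --> at_ a] --> (0 : C).
  apply/cvgrPdist_le => e e0; move/cvgrPdist_le/(_ _ e0): Ba => Ba.
  near=> x; rewrite sub0r normrN.
  have h1 : `|f x - p.[x - a]| <= B * `|x - a| ^+ n by near: x.
  have h2 : `|0 - B * `|x - a| ^+ n| <= e by near: x.
  apply: (le_trans h1); rewrite (le_trans _ h2) // sub0r normrN.
  apply: real_ler_norm; apply: ger0_real; exact: le_trans (normr_ge0 _) h1.
move=> fp0.
have : (f x - p.[x - a]) + p.[x - a] @[x --> at_ a] --> 0 + p.[0] by exact: cvgD.
by rewrite add0r; under eq_fun do rewrite subrK.
Unshelve. all: by end_near.
Qed.

Lemma smooth_cvg f a : smooth f -> K a -> f @ at_ a --> f a.
Proof.
move=> fs Ka; have [p fp] := fs a Ka 1%N.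
by rewrite (jet_center Ka _ fp) //; exact: jet_cvg fp.
Qed.

Lemma smooth_horner p : smooth (horner p).
Proof.
move=> a _ n; exists (p \Po ('X + a%:P)), 0; near=> x.
by rewrite horner_comp !hornerE subrK subrr normr0.
Unshelve. all: by end_near.
Qed.

Lemma jetB n f g a p q : jet n f a p -> jet n g a q ->
  jet n (fun x => f x - g x) a (p - q).
Proof.
move=> [B1 fp] [B2 gq]; exists (B1 + B2); near=> x.
rewrite hornerD hornerN (_ : _ - _ = (f x - p.[x - a]) - (g x - q.[x - a])); last by ring.
rewrite (le_trans (ler_normB _ _)) // mulrDl lerD //; near: x => //.
Unshelve. all: by end_near.
Qed.

Lemma smoothB f g : smooth f -> smooth g -> smooth (fun x => f x - g x).
Proof.
move=> fs gs a Ka n; have [p fp] := fs a Ka n; have [q gq] := gs a Ka n.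
by exists (p - q); exact: jetB.
Qed.

(** A term of order n disappears in the error, so operations on jets reduce to operations on
    polynomials modulo X ^ n. *)
Lemma jet_mod n f a p q s : jet n f a p -> p = q + 'X^n * s -> jet n f a q.
Proof.
move=> [B fp] pE; exists (B + (`|s.[0]| + 1)); near=> x.
rewrite (_ : _ - _ = (f x - p.[x - a]) + (x - a) ^+ n * s.[x - a]); last first.
  by rewrite pE !hornerE /=; ring.
rewrite (le_trans (ler_normD _ _)) // mulrDl lerD //; first by near: x.
rewrite normrM normrX mulrC ler_wpM2r ?exprn_ge0 //.
by near: x; exact: horner_near_bounded.
Unshelve. all: by end_near.
Qed.

(* Hensel lifting of the root b of t ^+ d = p.[0]. *)
Lemma poly_root_mod (d : nat) (b : C) p n : (0 < d)%N -> b != 0 -> p.[0] = b ^+ d ->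
  exists q s : {poly C}, [/\ q.[0] = b & p = q ^+ d + 'X^(n.+1) * s].
Proof.
move=> d0 b0 pb.
have divX (r : {poly C}) : r.[0] = 0 -> exists r', r = 'X * r'.
  by move=> /eqP/factor_theorem[r' ->]; exists r'; rewrite subr0 mulrC.
elim: n => [|n [q [s [q0 pE]]]].
  have [r rE] : exists r, p - (b ^+ d)%:P = 'X * r.
    by apply: divX; rewrite hornerD hornerN hornerC pb subrr.
  exists b%:P, r; split; first by rewrite hornerC.
  by rewrite -polyC_exp expr1 -rE addrC subrK.
have [t tE] : exists t, d%:R * b ^+ d.-1 * t = s.[0].
  exists (s.[0] / (d%:R * b ^+ d.-1)); rewrite mulrC divfK // mulf_neq0 //.
    by rewrite pnatr_eq0 -lt0n.
  by rewrite expf_neq0.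
have expand (u : {poly C}) : exists W, (q + u) ^+ d = q ^+ d + (q ^+ d.-1 * u) *+ d + u ^+ 2 * W.
  case: (d) d0 => // e _.
  exists (\sum_(i < e) (q ^+ (e.+1 - i.+2) * u ^+ i *+ 'C(e.+1, i.+2))).
  rewrite exprDn !big_ord_recl /= subn0 expr0 mulr1 bin0 mulr1n.
  rewrite /bump /= add1n expr1 subSS subn0 bin1 -addrA; congr (_ + (_ + _)).
  rewrite mulr_sumr; apply: eq_bigr => i _; rewrite /bump /= !add1n.
  by rewrite mulrnAr; congr (_ *+ _); rewrite [RHS]mulrCA -exprD add2n.
have [W WE] := expand ('X^(n.+1) * t%:P).
have [r rE] : exists r, s - (q ^+ d.-1 * t%:P) *+ d = 'X * r.
  apply: divX; rewrite hornerD hornerN hornerMn hornerM hornerC horner_exp q0.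
  by rewrite -tE -[(_ * t) *+ _]mulr_natl mulrA subrr.
exists (q + 'X^(n.+1) * t%:P), (r - 'X^n * t%:P ^+ 2 * W); split.
  by rewrite hornerD hornerM hornerXn expr0n /= mul0r addr0.
rewrite WE pE.
rewrite (_ : s = 'X * r + (q ^+ d.-1 * t%:P) *+ d); last by rewrite -rE subrK.
by rewrite !exprS; ring.
Qed.

(** The jet of f has a d-th root q modulo X ^ (n + 1) with q(0) = g a. Then g ^ d - q ^ d is small,
    and its cofactor over g - q stays away from 0 because the continuous g follows the same branch
    as q. *)
Lemma smooth_root (d : nat) f g : (0 < d)%N -> smooth f ->
  (forall a, K a -> g @ at_ a --> g a) -> (forall x, K x -> g x ^+ d = f x) ->
  (forall x, K x -> f x != 0) -> smooth g.
Proof.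
move=> d0 fs gc gf f0 a Ka [|n].
  (* Order 0 asks only for boundedness near a. *)
  exists 0, (`|g a| + 1); near=> x.
  rewrite horner0 subr0 expr0 mulr1; near: x.
  by apply: (cvgr_norm_le (g a)); [exact: gc | rewrite ltrDl].
have [p fp] := fs a Ka n.+1.
have b0 : g a != 0 by have := f0 a Ka; rewrite -gf // expf_eq0 d0.
have [q [s [q0 pE]]] : exists q s : {poly C}, [/\ q.[0] = g a & p = q ^+ d + 'X^(n.+1) * s].
  by apply: poly_root_mod => //; rewrite -(jet_center Ka _ fp) // gf.
have [B fq] := jet_mod fp pE.
have cof : \sum_(i < d) g x ^+ (d.-1 - i) * q.[x - a] ^+ i @[x --> at_ a]
    --> d%:R * g a ^+ d.-1.
  apply: cvg_subrXX_cofactor; first exact: gc.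
  by rewrite -q0; apply: cvg_horner; exact: at_cvg0.
have cof0 : d%:R * g a ^+ d.-1 != 0.
  by rewrite mulf_neq0 ?expf_neq0 // pnatr_eq0 -lt0n.
set c := d%:R * g a ^+ d.-1 in cof cof0.
have c2 : 0 < `|c| / 2 by rewrite divr_gt0 // normr_gt0.
exists q, (B / (`|c| / 2)); near=> x.
have Kx : K x by near: x; exact: withinT.
have h1 : `|c| / 2 <= `|\sum_(i < d) g x ^+ (d.-1 - i) * q.[x - a] ^+ i|.
  by near: x; exact: near_norm_ge_half.
have h2 : `|f x - (q ^+ d).[x - a]| <= B * `|x - a| ^+ n.+1 by near: x.
rewrite mulrAC ler_pdivlMr // (le_trans _ h2) // -gf // horner_exp subrXX [leRHS]normrM.
by rewrite ler_wpM2l // (le_trans h1).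
Unshelve. all: by end_near.
Qed.

(** With X standing for x - a, the polynomial X + a is x itself, a unit modulo X ^ n when a is
    nonzero. *)
Lemma poly_quotient_mod (a : C) p n : a != 0 ->
  exists q s : {poly C}, p = ('X + a%:P) * q + 'X^n * s.
Proof.
move=> a0; elim: n => [|n [q [s ->]]].
  by exists 0, p; rewrite mulr0 add0r expr0 mul1r.
have [r rE] : exists r, s = 'X * r + s.[0]%:P.
  have /factor_theorem[r rE] : root (s - s.[0]%:P) 0.
    by rewrite rootE hornerD hornerN hornerC subrr.
  by exists r; rewrite mulrC -[X in _ * X]subr0 -rE subrK.
set s0 := s.[0] in rE; exists (q + (s0 / a) *: 'X^n), (r - (s0 / a)%:P).
have s0E : s0%:P = (s0 / a)%:P * a%:P :> {poly C} by rewrite -polyCM divfK.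
by rewrite rE s0E -mul_polyC exprS; ring.
Qed.

Definition slope0 f c x := if x == 0 then c else (f x - f 0) / x.

Lemma jetW n f a p : jet n.+1 f a p -> jet n f a p.
Proof.
move=> [B fp]; exists `|B|; near=> x.
have h1 : `|f x - p.[x - a]| <= B * `|x - a| ^+ n.+1 by near: x.
have h2 : `|x - a| <= 1.
  near: x; apply: (@cvgr_norm_le _ _ _ _ _ _ (0 : C)); first exact: at_cvg0.
  by rewrite normr0 ltr01.
rewrite (le_trans h1) // -[leLHS]ger0_norm ?(le_trans _ h1) // normrM ler_wpM2l //.
by rewrite normrX normr_id exprS ler_piMl // exprn_ge0.
Unshelve. all: by end_near.
Qed.

(** At a nonzero point the jet of f - f 0 is divided by X + a modulo X ^ n. At 0 the constant term
    is removed and X cancelled; uniqueness of limits identifies the new constant term with c. *)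
Lemma smooth_slope0 f c : nbhs 0 K -> (f x - f 0) / x @[x --> 0^'] --> c ->
  smooth f -> smooth (slope0 f c).
Proof.
move=> K0 fc fs a Ka n; have [a0|a0] := eqVneq a 0.
(* One order is lost in the division by x; the other keeps the order positive even for n = 0, as the
   passage to the limit by [jet_cvg] requires. *)
- rewrite a0 in Ka *; have [p fp] := fs 0 Ka n.+2.
  have [r rE] : exists r, p - p.[0]%:P = 'X * r.
    have /factor_theorem[r ->] : root (p - p.[0]%:P) 0.
      by rewrite rootE hornerD hornerN hornerC subrr.
    by exists r; rewrite subr0 mulrC.
  have f0 := jet_center Ka (ltn0Sn _) fp.
  have [B slopeB] : exists B, \forall x \near 0^', `|(f x - f 0) / x - r.[x]| <= B * `|x| ^+ n.+1.
    have [B fB] := fp; exists B.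
    have {}fB : \forall x \near 0^', `|f x - p.[x]| <= B * `|x| ^+ n.+2.
      apply: nbhs_dnbhs; apply: (near_interior K0).
      by move: fB; under eq_near do rewrite subr0.
    near=> x; have x0 : x != 0 by near: x; exact: nbhs_dnbhs_neq.
    have h : `|f x - p.[x]| <= B * `|x| ^+ n.+2 by near: x.
    have xn : 0 < `|x| by rewrite normr_gt0.
    rewrite -(ler_pM2r xn) -mulrA -exprSr -normrM mulrBl divfK //.
    have -> : r.[x] * x = p.[x] - p.[0].
      transitivity ('X * r).[x]; first by rewrite hornerM hornerX mulrC.
      by rewrite -rE !hornerE.
    by rewrite f0 opprB addrA subrK.
  have slope_jet : jet n.+1 (slope0 f r.[0]) 0 r.
    exists B; apply: cvg_within; move: slopeB; rewrite near_withinE.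
    apply: filterS => x H; rewrite subr0 /slope0.
    have [->|x0] := eqVneq x 0; last exact: H.
    by rewrite subrr !normr0 expr0n mulr0.
  have rc : r.[0] = c.
    apply: (@cvg_unique _ _ ((f x - f 0) / x @[x --> 0^'])) => //.
    have := jet_cvg (ltn0Sn _) slope_jet => H A /H/(near_interior K0)/nbhs_dnbhs.
    apply: filterS2 (nbhs_dnbhs_neq 0) => x x0; by rewrite /= /slope0 (negPf x0).
  by exists r; apply: jetW; rewrite -rc.
- have [p' fp] : exists p, jet n (fun x => f x - f 0) a p.
    have [p' fp] := fs a Ka n; exists (p' - (f 0)%:P); apply: jetB => //.
    by exists 0; near=> x; rewrite hornerC subrr normr0 mul0r.
  have [q [s pE]] := poly_quotient_mod p' n a0.
  have [B fq] := jet_mod fp pE.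
  have a2 : 0 < `|a| / 2 by rewrite divr_gt0 // normr_gt0.
  exists q, (B / (`|a| / 2)); near=> x.
  have h1 : `|a| / 2 <= `|x| by near: x; apply: near_norm_ge_half => //; exact: at_cvg.
  have x0 : x != 0 by rewrite -normr_gt0 (lt_le_trans a2).
  have h2 : `|f x - f 0 - (('X + a%:P) * q).[x - a]| <= B * `|x - a| ^+ n by near: x.
  rewrite /slope0 (negPf x0) mulrAC ler_pdivlMr // (le_trans _ h2) //.
  rewrite hornerM hornerD hornerX hornerC subrK.
  rewrite [X in _ <= X](_ : _ = `|(f x - f 0) / x - q.[x - a]| * `|x|).
    by rewrite ler_wpM2l.
  by rewrite -normrM mulrBl divfK // [x * _]mulrC.
Unshelve. all: by end_near.
Qed.

(** The first and second power sums of 1, -1, i, -i vanish, so the linear and quadratic terms of the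
    jet cancel and a cubic error remains. *)
Lemma smooth_four_points f a (i : C) : i ^+ 2 = -1 -> nbhs a K -> smooth f ->
  exists B, \forall h \near 0,
    `|f (a + h) + f (a - h) + f (a + i * h) + f (a - i * h) - 4%:R * f a|
      <= B * `|h| ^+ 3.
Proof.
move=> i2 aK fs; have Ka : K a by exact: nbhs_singleton.
have [p fp] := fs a Ka 3%N.
have fq : jet 3 f a (take_poly 3 p).
  by apply: (jet_mod (s := drop_poly 3 p) fp); rewrite mulrC poly_take_drop.
have f0 := jet_center Ka (ltn0Sn 2) fq.
set q := take_poly 3 p in fq f0.
have qE x : q.[x] = q`_0 + q`_1 * x + q`_2 * x ^+ 2.
  rewrite (horner_coef_wide _ (size_take_poly 3 p)) !big_ord_recl big_ord0 /=.
  by rewrite /bump /= !addn0 add1n !expr0 expr1 mulr1 addr0 addrA.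
have [B {}fq] := fq; have {fq}/(near_interior aK) fq := fq.
have near_dir (c : C) : `|c| = 1 ->
    \forall h \near 0, `|f (a + c * h) - q.[c * h]| <= B * `|h| ^+ 3.
  move=> c1; have := @cvg_horner C C (nbhs (0 : C)) (nbhs_filter _) (a%:P + c *: 'X) id 0 cvg_id.
  rewrite !hornerE /=; under eq_fun do rewrite !hornerE /=.
  move=> H; have := H _ fq; rewrite /= => {}H; near=> h.
  have : `|f (a + c * h) - q.[a + c * h - a]| <= B * `|a + c * h - a| ^+ 3 by near: h.
  by rewrite [a + c * h - a]addrC addKr normrM c1 mul1r.
have i1 : `|i| = 1.
  by apply/eqP; rewrite -(@pexpr_eq1 _ _ 2) // -normrX i2 normrN1.
exists (B + B + B + B).
have N1 := near_dir 1 (normr1 _); have N2 := near_dir (-1) (normrN1 _).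
have N3 := near_dir i i1.
have N4 : \forall h \near 0, `|f (a + - i * h) - q.[- i * h]| <= B * `|h| ^+ 3.
  by apply: near_dir; rewrite normrN.
near=> h.
have h1 : `|f (a + 1 * h) - q.[1 * h]| <= B * `|h| ^+ 3 by near: h.
have h2 : `|f (a + -1 * h) - q.[-1 * h]| <= B * `|h| ^+ 3 by near: h.
have h3 : `|f (a + i * h) - q.[i * h]| <= B * `|h| ^+ 3 by near: h.
have h4 : `|f (a + - i * h) - q.[- i * h]| <= B * `|h| ^+ 3 by near: h.
rewrite mul1r mulN1r mulNr in h1 h2 h4 *.
rewrite (_ : _ - _ = (f (a + h) - q.[h]) + (f (a - h) - q.[- h])
  + (f (a + i * h) - q.[i * h]) + (f (a - i * h) - q.[- (i * h)])).
  rewrite !mulrDl; do 3 ?[rewrite (le_trans (ler_normD _ _)) // lerD //].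
rewrite f0 !qE (_ : (i * h) ^+ 2 = - h ^+ 2); last by rewrite exprMn i2 mulN1r.
rewrite (_ : (- (i * h)) ^+ 2 = - h ^+ 2); last by rewrite sqrrN exprMn i2 mulN1r.
by ring.
Unshelve. all: by end_near.
Qed.

End Jets.

(** Close to 1 the map t -> t ^ d satisfies |s - t| <= 2 |s ^ d - t ^ d|. Roots chosen pointwise
    there are therefore unique, and the choice is continuous. *)
Lemma exists_local_root (C : numFieldType) (d : nat) : (0 < d)%N ->
  (forall w rho : C, 0 < rho -> `|w - 1| < rho ^+ d ->
    exists2 t, t ^+ d = w & `|t - 1| <= rho) ->
  exists2 eta : C, 0 < eta & exists rt : C -> C, rt 1 = 1 /\
    forall w : C, `|w - 1| < eta -> rt w ^+ d = w /\ (rt x @[x --> w] --> rt w).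
Proof.
move=> d0 close_root.
have [rho rho0 rhoP] : exists2 rho : C, 0 < rho & forall s t, `|s - 1| <= rho -> `|t - 1| <= rho ->
    `|s - t| <= 2%:R * `|s ^+ d - t ^+ d|.
  have cof : \sum_(i < d) p.1 ^+ (d.-1 - i) * p.2 ^+ i
      @[p --> ((1, 1) : C * C)] --> (d%:R * 1 ^+ d.-1 : C).
    by apply: cvg_subrXX_cofactor; [exact: cvg_fst | exact: cvg_snd].
  rewrite expr1n mulr1 in cof.
  have dn0 : d%:R != 0 :> C by rewrite pnatr_eq0 -lt0n.
  have [[U V] /= [U1 V1] UV] := near_norm_ge_half cof dn0.
  have /nbhs_normP[e /= e0 eUV] : nbhs (1 : C) (U `&` V) by exact: filterI.
  exists (e / 2) => [|s t s1 t1]; first by rewrite divr_gt0.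
  have e2 : e / 2 < e by rewrite gtr_pMr // invf_lt1 // ltr1n.
  have [Us _] : (U `&` V) s by apply: eUV; rewrite /ball_ /= distrC (le_lt_trans s1).
  have [_ Vt] : (U `&` V) t by apply: eUV; rewrite /ball_ /= distrC (le_lt_trans t1).
  have := UV (s, t) (conj Us Vt); rewrite /= => h.
  (* The constant 2: near (1, 1) the cofactor has norm at least d / 2, hence at least 1 / 2. *)
  rewrite subrXX normrM mulrCA ler_peMr //.
  rewrite -(ler_pM2l (_ : 0 < 2^-1 :> C)) ?invr_gt0 // mulr1 mulKf ?pnatr_eq0 //.
  rewrite (le_trans _ h) // normr_nat ler_peMl // ?invr_ge0 // ler1n //.
exists (rho ^+ d); first by rewrite exprn_gt0.
have rtP (w : C) : exists t, `|w - 1| < rho ^+ d -> t ^+ d = w /\ `|t - 1| <= rho.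
  have [w1|] := boolP (`|w - 1| < rho ^+ d); last by exists 0.
  by have [t tw t1] := close_root _ _ rho0 w1; exists t.
have [rt {}rtP] := choice rtP; exists rt.
have inj s t : `|s - 1| <= rho -> `|t - 1| <= rho -> s ^+ d = t ^+ d -> s = t.
  move=> s1 t1 st; apply/eqP; rewrite -subr_eq0 -normr_le0.
  by rewrite (le_trans (rhoP _ _ s1 t1)) // st subrr normr0 mulr0.
split.
  have [|r1 r1'] := rtP 1; first by rewrite subrr normr0 exprn_gt0.
  by apply: inj => //; [rewrite subrr normr0 ltW | rewrite r1 expr1n].
move=> w w1; have [rw rw'] := rtP w w1; split=> //.
have Fw : Filter (nbhs w) by exact: nbhs_filter.
apply/(@cvgrPdist_le C C _ (nbhs w) Fw rt (rt w)) => e e0.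
have w1' : \forall v \near w, `|v - 1| < rho ^+ d.
  apply: (@cvgr_norm_lt C C _ (nbhs w) Fw _ (w - 1)) => //.
  by apply: cvgB; [exact: cvg_id | exact: cvg_cst].
have we : \forall v \near w, `|w - v| <= e / 2.
  by move: (@cvg_id _ (nbhs w)) => /cvgrPdist_le; apply; rewrite divr_gt0.
near=> v; have [rv rv'] : rt v ^+ d = v /\ `|rt v - 1| <= rho by apply: rtP; near: v.
rewrite (le_trans (rhoP _ _ rw' rv')) // rw rv mulrC -ler_pdivlMr //.
by near: v.
Unshelve. all: by end_near.
Qed.


Lemma cvg_slopeB (C : numFieldType) (f g : C -> C) (a b : C) :
  (f x - f 0) / x @[x --> 0^'] --> a -> (g x - g 0) / x @[x --> 0^'] --> b ->
  ((f x - g x) - (f 0 - g 0)) / x @[x --> 0^'] --> a - b.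
Proof.
move=> fa gb.
have : (f x - f 0) / x - (g x - g 0) / x @[x --> 0^'] --> a - b by exact: cvgB.
apply: cvg_trans; apply: near_eq_cvg; near=> x.
by rewrite -mulrBl; congr (_ / _); ring.
Unshelve. all: by end_near.
Qed.

Section RootSlope.
Variables (C : numFieldType) (d : nat) (f g : C -> C) (e : C).

Lemma cvg_slope_root : (0 < d)%N -> g 0 != 0 -> g 0 ^+ d = f 0 ->
  (\forall x \near 0^', g x ^+ d = f x) -> g x @[x --> 0^'] --> g 0 ->
  (f x - f 0) / x @[x --> 0^'] --> e ->
  (g x - g 0) / x @[x --> 0^'] --> e / (d%:R * g 0 ^+ d.-1).
Proof.
move=> d0 g0 gf0 gf gc fe.
have cof : \sum_(i < d) g x ^+ (d.-1 - i) * cst (g 0) x ^+ i @[x --> 0^']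
    --> d%:R * g 0 ^+ d.-1.
  by apply: cvg_subrXX_cofactor => //; exact: cvg_cst.
have cof0 : d%:R * g 0 ^+ d.-1 != 0 by rewrite mulf_neq0 ?expf_neq0 // pnatr_eq0 -lt0n.
have : (f x - f 0) / x / (\sum_(i < d) g x ^+ (d.-1 - i) * cst (g 0) x ^+ i)
    @[x --> 0^'] --> e / (d%:R * g 0 ^+ d.-1).
  by apply: cvgM => //; exact: cvgV.
apply: cvg_trans; apply: near_eq_cvg.
near=> x.
have cofx : \sum_(i < d) g x ^+ (d.-1 - i) * cst (g 0) x ^+ i != 0.
  have h : `|d%:R * g 0 ^+ d.-1| / 2 <= `|\sum_(i < d) g x ^+ (d.-1 - i) * cst (g 0) x ^+ i|.
    by near: x; exact: near_norm_ge_half.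
  by rewrite -normr_gt0 (lt_le_trans _ h) // divr_gt0 // normr_gt0.
have gfx : g x ^+ d = f x by near: x.
by rewrite -gfx -gf0 subrXX [LHS]mulrAC mulfK.
Unshelve. all: by end_near.
Qed.
End RootSlope.

Lemma near_affine_neq (C : numFieldType) (a a' b b' : C) : a != a' ->
  \forall x \near (0 : C), a + b * x != a' + b' * x.
Proof.
move=> aa'; have b1 : 0 < `|b' - b| + 1 by rewrite ltr_wpDl.
apply/nbhs_norm0P; exists (`|a - a'| / (`|b' - b| + 1)) => [|x] /=.
  by rewrite divr_gt0 // normr_gt0 subr_eq0.
rewrite ltr_pdivlMr // => xe; apply/eqP => E.
have aE : a - a' = (b' - b) * x.
  by apply/eqP; rewrite -subr_eq0; apply/eqP; rewrite mulrBl opprB addrACA E; ring.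
move: xe; rewrite aE normrM mulrC ltr_pM2r ?normr_gt0; last first.
  by apply/eqP => x0; move: aE; rewrite x0 mulr0 => /eqP; rewrite subr_eq0 (negPf aa').
by rewrite gtrDl ltr10.
Qed.

(** * Maximum principle, Cauchy estimate and continuous roots *)

Lemma telescope_prodf (F : fieldType) n (g : nat -> F) :
  (forall i, (i <= n)%N -> g i != 0) -> \prod_(i < n) (g i.+1 / g i) = g n / g 0%N.
Proof.
elim: n => [|n IH] g0; first by rewrite big_ord0 divff // g0.
rewrite big_ord_recr /= IH => [|i ni]; last by rewrite g0 // ltnW.
by rewrite mulrC mulrA divfK // g0.
Qed.

Section ComplexPlane.
Variable R : realType.
Local Notation C := (R[i] : numFieldType).
Local Notation Re := (@complex.Re R).
Local Notation Im := (@complex.Im R).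

Lemma normC_real (x : C) : `|x| = (Re `|x|)%:C%C.
Proof. by rewrite RRe_real // normr_real. Qed.

Lemma complexReB (x y : C) : Re (x - y) = Re x - Re y. Proof. by case: x; case: y. Qed.
Lemma complexImB (x y : C) : Im (x - y) = Im x - Im y. Proof. by case: x; case: y. Qed.
Lemma complexReD (x y : C) : Re (x + y) = Re x + Re y. Proof. by case: x; case: y. Qed.
Lemma complexImD (x y : C) : Im (x + y) = Im x + Im y. Proof. by case: x; case: y. Qed.
Lemma complexReM (x y : C) : Re (x * y) = Re x * Re y - Im x * Im y.
Proof. by case: x; case: y. Qed.
Lemma complexImM (x y : C) : Im (x * y) = Re x * Im y + Im x * Re y.
Proof. by case: x; case: y. Qed.

Lemma norm_Re_le (x : C) : `|Re x| <= Re `|x|.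
Proof. by have := normc_ge_Re x; rewrite normC_real lecR. Qed.

Lemma norm_complexi : `|'i%C : C| = 1.
Proof. by rewrite normc_def /= expr0n add0r expr1n sqrtr1. Qed.

Lemma norm_complex_real (t : R) : `|t%:C%C : C| = `|t|%:C%C.
Proof. by rewrite normc_def /= expr0n addr0 sqrtr_sqr. Qed.

Lemma norm_Im_le (x : C) : `|Im x| <= Re `|x|.
Proof.
have := norm_Re_le (x * 'i%C); rewrite ReiNIm normrN normrM norm_complexi mulr1 //.
Qed.

Lemma cvg_Re (T : Type) (F : set_system T) {FF : Filter F} (f : T -> C) (a : C) :
  f @ F --> a -> Re (f x) @[x --> F] --> Re a.
Proof.
move=> /cvgrPdist_le fa; apply/cvgrPdist_le => e e0.
have := fa e%:C%C; rewrite ltcR => /(_ e0); apply: filterS => x.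
by rewrite normC_real lecR -complexReB; apply: le_trans; exact: norm_Re_le.
Qed.

Lemma cvg_Im (T : Type) (F : set_system T) {FF : Filter F} (f : T -> C) (a : C) :
  f @ F --> a -> Im (f x) @[x --> F] --> Im a.
Proof.
move=> /cvgrPdist_le fa; apply/cvgrPdist_le => e e0.
have := fa e%:C%C; rewrite ltcR => /(_ e0); apply: filterS => x.
by rewrite normC_real lecR -complexImB; apply: le_trans; exact: norm_Im_le.
Qed.

(** It serves as a disc: compact as the image of a product of segments, star-shaped about 0, and
    with all boundary points of norm at least r. *)
Definition square (r : R) : set C := [set x | `|Re x| <= r /\ `|Im x| <= r].

Lemma compact_square r : compact (square r).
Proof.
have -> : square r = (fun p : R * R => (p.1 +i* p.2)%C) @` (`[- r, r] `*` `[- r, r]).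
  apply/seteqP; split => [[a b] /= [ra rb]|_ [[a b] /= [ra rb] <-]].
    by exists (a, b) => //=; split; rewrite /= in_itv /= -ler_norml.
  by move: ra rb; rewrite /= !in_itv /= -!ler_norml.
apply: continuous_compact; last by apply: compact_setX; exact: segment_compact.
apply: continuous_subspaceT => p; apply/cvgrPdist_le => e e0.
have [c ce] : exists c : R, e = c%:C%C.
  by exists (Re e); rewrite RRe_real // ger0_real // ltW.
rewrite ce ltcR in e0 *.
have c2 : 0 < c / 2 by rewrite divr_gt0.
have fst_p : fst q @[q --> p] --> p.1 by exact: cvg_fst.
have snd_p : snd q @[q --> p] --> p.2 by exact: cvg_snd.
near=> q.
have h1 : `|p.1 - q.1| <= c / 2 by near: q; move/cvgrPdist_le: fst_p; exact.
have h2 : `|p.2 - q.2| <= c / 2 by near: q; move/cvgrPdist_le: snd_p; exact.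
rewrite (_ : _ - _ = (p.1 - q.1)%:C%C + 'i%C * (p.2 - q.2)%:C%C); last first.
  by apply/eqP; rewrite eq_complex /=; apply/andP; split; apply/eqP; ring.
rewrite (le_trans (ler_normD _ _)) // normrM norm_complexi mul1r.
by rewrite !norm_complex_real -rmorphD lecR [leRHS]splitr lerD.
Unshelve. all: by end_near.
Qed.

Lemma square_nbhs r (x : C) : `|Re x| < r -> `|Im x| < r -> nbhs x (square r).
Proof.
move=> xr xi; near=> y; split; rewrite ltW //; near: y.
  by apply: (cvgr_norm_lt (Re x)) xr; apply: cvg_Re; exact: cvg_id.
by apply: (cvgr_norm_lt (Im x)) xi; apply: cvg_Im; exact: cvg_id.
Unshelve. all: by end_near.
Qed.

Lemma square_boundary r (x : C) : square r x ->
  nbhs x (square r) \/ r <= Re `|x|.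
Proof.
move=> [xr xi]; have [xr'|xr'] := ltP `|Re x| r.
  have [xi'|xi'] := ltP `|Im x| r; first by left; exact: square_nbhs.
  by right; exact: le_trans (norm_Im_le x).
by right; exact: le_trans (norm_Re_le x).
Qed.

(* Maximise Re (u * G) + eps * |.|^2 with eps small: at an interior maximum the
   four-point mean property contradicts the strict subharmonicity of |.|^2. *)
Lemma max_principle (K : set C) (G : C -> C) (b : R) : compact K ->
  (forall a, K a -> G @ within K (nbhs a) --> G a) ->
  (forall a, K a -> Re `|G a| <= b \/
    (nbhs a K /\ exists B, \forall h \near (0 : C),
      `|G (a + h) + G (a - h) + G (a + 'i%C * h) + G (a - 'i%C * h) - 4%:R * G a|
        <= B * `|h| ^+ 3)) ->
  forall x, K x -> Re `|G x| <= b.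
Proof.
move=> Kc Gc Gb x0 Kx0; rewrite leNgt; apply/negP => Gx0.
have [u u1 uG] : exists2 u : C, `|u| = 1 & u * G x0 = `|G x0|.
  have [->|G0] := eqVneq (G x0) 0; first by exists 1; rewrite ?normr1 // mulr0 normr0.
  exists (`|G x0| / G x0); last by rewrite divfK.
  by rewrite normrM normfV normr_id divff // normr_eq0.
pose q (x : C) := Re x ^+ 2 + Im x ^+ 2.
have qc (a : C) : q @ within K (nbhs a) --> q a.
  by apply: cvgD; apply: cvgM; (apply: cvg_Re || apply: cvg_Im); exact: cvg_within.
have Kn0 : K !=set0 by exists x0.
have [c cK qmax] : exists2 c, c \in K & forall t, t \in K -> q t <= q c.
  apply: compact_EVT_max => //; apply/subspace_continuousP => x _; exact: qc.
have q_ge0 x : 0 <= q x by rewrite addr_ge0 // sqr_ge0.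
(* On [K] the added term eps * q is at most half the gap between |G x0| and b, so the maximum of
   [Phi] cannot lie at a point where |G| <= b. *)
pose eps := (Re `|G x0| - b) / (2 * (q c + 1)).
have qc1 : 0 < q c + 1 by rewrite ltr_wpDl.
have eps0 : 0 < eps by rewrite divr_gt0 ?subr_gt0 // mulr_gt0.
pose Phi x := Re (u * G x) + eps * q x.
have [a aK Pmax] : exists2 a, a \in K & forall t, t \in K -> Phi t <= Phi a.
  apply: compact_EVT_max => //; apply/subspace_continuousP => x Kx.
  apply: cvgD; first by apply: cvg_Re; apply: cvgM; [exact: cvg_cst | exact: Gc].
  by apply: cvgM; [exact: cvg_cst | exact: qc].
have RuG x : Re (u * G x) <= Re `|G x|.
  rewrite (le_trans (ler_norm _)) // (le_trans (norm_Re_le _)) //.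
  by rewrite normrM u1 mul1r.
have Px0 : Re `|G x0| <= Phi a.
  rewrite (le_trans _ (Pmax x0 _)) ?inE // /Phi uG lerDl mulr_ge0 // ltW //.
move: aK; rewrite inE => Ka; have [Gab|[aK [B fourB]]] := Gb a Ka.
  have : Phi a <= b + (Re `|G x0| - b) / 2.
    rewrite lerD // ?(le_trans (RuG a)) // /eps.
    have qa : q a <= q c + 1 by rewrite (le_trans (qmax _ _)) ?inE // lerDl.
    rewrite [leRHS](_ : _ = (Re `|G x0| - b) / (2 * (q c + 1)) * (q c + 1)).
      by rewrite ler_wpM2l // ltW.
    by field; rewrite gt_eqF.
  move=> h; have := le_trans Px0 h; move: Gx0; lra.
have shift (c0 : C) : `|c0| = 1 -> \forall h \near (0 : C), K (a + c0 * h).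
  move=> c1; move: aK => /nbhs_normP[e /= e0 eK].
  apply: (@nbhs_norm0P _ C _).2; exists e => //= h he; apply: eK => /=.
  by rewrite /ball_ /= opprD addrA subrr sub0r normrN normrM c1 mul1r.
have i1 : `|'i%C : C| = 1 by exact: norm_complexi.
have : \forall h \near (0 : C),
   [/\ K (a + 1 * h), K (a + -1 * h), K (a + 'i%C * h) & K (a + - 'i%C * h)] /\
   `|G (a + h) + G (a - h) + G (a + 'i%C * h) + G (a - 'i%C * h) - 4%:R * G a|
        <= B * `|h| ^+ 3.
  near=> h; split; last by near: h.
  by split; near: h; apply: shift; rewrite ?normrN ?normr1.
move=> fourK; have [e /= e0 eP] := (@nbhs_norm0P _ C _).1 fourK.
have [e1 e1E] : exists e1 : R, e = e1%:C%C.
  by exists (Re e); rewrite RRe_real // ger0_real // ltW.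
rewrite e1E ltcR in e0 eP.
(* The first bound keeps the four points in [K] with the expansion valid; the second makes the cubic
   error at most eps * t ^ 2, less than the gain 4 * eps * t ^ 2 from the quadratic term. *)
pose t := Num.min (e1 / 2) (eps / (`|Re B| + 1)).
have B1 : 0 < `|Re B| + 1 by rewrite ltr_wpDl.
have t0 : 0 < t by rewrite lt_min; apply/andP; split; rewrite divr_gt0.
have nt : `|t%:C%C : C| = t%:C%C by rewrite norm_complex_real gtr0_norm.
have [[K1 K2 K3 K4] four] :
   [/\ K (a + 1 * t%:C%C), K (a + -1 * t%:C%C), K (a + 'i%C * t%:C%C) &
       K (a + - 'i%C * t%:C%C)] /\
   `|G (a + t%:C%C) + G (a - t%:C%C) + G (a + 'i%C * t%:C%C) + G (a - 'i%C * t%:C%C) - 4%:R * G a|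
        <= B * `|t%:C%C : C| ^+ 3.
  apply: eP; rewrite /= nt ltcR; have : t <= e1 / 2 by rewrite ge_min lexx.
  by move: e0; lra.
have P1 : Phi (a + 1 * t%:C%C) <= Phi a by apply: Pmax; rewrite inE.
have P2 : Phi (a + -1 * t%:C%C) <= Phi a by apply: Pmax; rewrite inE.
have P3 : Phi (a + 'i%C * t%:C%C) <= Phi a by apply: Pmax; rewrite inE.
have P4 : Phi (a + - 'i%C * t%:C%C) <= Phi a by apply: Pmax; rewrite inE.
rewrite mul1r mulN1r mulNr in P1 P2 P4.
set S := _ - _ in four.
have ReS : - (Re B * t ^+ 3) <= Re (u * S).
  have h : Re `|S| <= Re B * t ^+ 3.
    move: four; rewrite lecE nt -rmorphXn => /andP[_].
    by rewrite [in leRHS]complexReM [Im (_%:C)%C]/= mulr0 subr0.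
  have := norm_Re_le (u * S); rewrite normrM u1 mul1r ler_norml => /andP[h' _].
  by rewrite (le_trans _ h') // lerN2.
have qsum : q (a + t%:C%C) + q (a - t%:C%C) + q (a + 'i%C * t%:C%C) + q (a - 'i%C * t%:C%C)
   = 4%:R * q a + 4%:R * t ^+ 2.
  rewrite /q !complexReD !complexImD; case: (a) => x y /=; ring.
have ReuS : Re (u * S) = Re (u * G (a + t%:C%C)) + Re (u * G (a - t%:C%C))
  + Re (u * G (a + 'i%C * t%:C%C)) + Re (u * G (a - 'i%C * t%:C%C)) - 4%:R * Re (u * G a).
  rewrite /S (_ : u * _ = u * G (a + t%:C%C) + u * G (a - t%:C%C)
    + u * G (a + 'i%C * t%:C%C) + u * G (a - 'i%C * t%:C%C)
    - (u * G a + u * G a + (u * G a + u * G a))); last by ring.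
  by rewrite complexReB !complexReD; ring.
have tB : (`|Re B| + 1) * t <= eps.
  by rewrite mulrC -ler_pdivlMr // ge_min lexx orbT.
have : Re (u * S) + eps * (4%:R * t ^+ 2) <= 0.
  rewrite ReuS; have := lerD (lerD P1 P2) (lerD P3 P4); rewrite /Phi => h.
  have := congr1 (fun y => eps * y) qsum; rewrite /= => qs; move: h; lra.
have h1 : Re B * t ^+ 3 <= eps * t ^+ 2.
  rewrite exprS mulrA ler_wpM2r ?sqr_ge0 // (le_trans _ tB) //.
  by rewrite ler_wpM2r ?ltW // ltr_pwDr // ler_norm.
have h2 : 0 < eps * t ^+ 2 by rewrite mulr_gt0 // exprn_gt0.
by move: ReS h1 h2; lra.
Unshelve. all: by end_near.
Qed.

(** Maximum principle for the difference quotient at 0: a boundary point has norm at least r, and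
    the numerator f x - f 0 is at most 2 M there. *)
Lemma cauchy_estimate (r M : R) (f : C -> C) (c : C) : 0 < r ->
  smooth (square r) f -> (f x - f 0) / x @[x --> 0^'] --> c ->
  (forall x, square r x -> Re `|f x| <= M) -> Re `|c| <= 2 * M / r.
Proof.
move=> r0 fs fc fM; have K0 : nbhs (0 : C) (square r) by apply: square_nbhs; rewrite normr0.
have gs := smooth_slope0 K0 fc fs.
have -> : c = slope0 f c 0 by rewrite /slope0 eqxx.
apply: (max_principle (@compact_square r)); last exact: (nbhs_singleton K0).
  by move=> a Ka; exact: smooth_cvg.
move=> a Ka; have [aK|ra] := square_boundary Ka; [right|left].
  split=> //; apply: smooth_four_points gs => //.
  exact: sqr_i.
have a0 : a != 0 by apply/eqP => a0; move: ra; rewrite a0 normr0 leNgt r0.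
rewrite /slope0 (negPf a0) ler_pdivlMr //.
have ga : `|(f a - f 0) / a| * `|a| = `|f a - f 0| by rewrite -normrM divfK.
have : Re `|(f a - f 0) / a| * Re `|a| = Re `|f a - f 0|.
  rewrite -ga [`|_ / _|]normC_real [`|a|]normC_real -rmorphM //.
have fB : Re `|f a - f 0| <= 2 * M.
  have := ler_normB (f a) (f 0); rewrite lecE complexReD => /andP[_] /le_trans; apply.
  by rewrite mulr_natl mulr2n lerD // fM //; exact: (nbhs_singleton K0).
move=> h; rewrite (le_trans _ fB) // -h ler_wpM2l //.
by have := normr_ge0 ((f a - f 0) / a); rewrite lecE => /andP[].
Qed.

(** |w - 1| is the product of the distances from 1 to the d roots of X ^ d - w; were all of them
    above rho, it would be at least rho ^ d. *)
Lemma exists_close_root (d : nat) (w rho : C) : (0 < d)%N -> 0 < rho ->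
  `|w - 1| < rho ^+ d -> exists2 t, t ^+ d = w & `|t - 1| <= rho.
Proof.
move=> d0 rho0 w1; pose p : {poly C} := 'X^d - w%:P.
have [rs pE] := closed_field_poly_normal (p : {poly (R[i] : closedFieldType)}).
have p_size : size p = d.+1 by exact: size_XnsubC.
have p_monic : p \is monic by exact: monicXnsubC.
rewrite (monicP p_monic) scale1r in pE.
have rs_size : size rs = d by apply/eqP; rewrite -eqSS -p_size pE size_prod_XsubC.
have [/hasP[t trs t1]|/hasPn far] := boolP (has (fun t => `|t - 1| <= rho) rs).
  exists t => //; have : root p t by rewrite pE root_prod_XsubC.
  by rewrite rootE !hornerE subr_eq0 => /eqP.
exfalso; move: w1; apply/negP.
rewrite -real_leNgt ?normr_real ?(gtr0_real (exprn_gt0 d rho0)) //.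
have -> : `|w - 1| = \prod_(t <- rs) `|t - 1|.
  rewrite distrC -normr_prod (_ : 1 - w = p.[1]); last by rewrite !hornerE expr1n.
  rewrite pE horner_prod normr_prod; rewrite normr_prod; apply: eq_bigr => t _.
  by rewrite !hornerE distrC.
rewrite -rs_size; have {}far t : t \in rs -> rho <= `|t - 1|.
  by move=> /far; rewrite -real_ltNge ?normr_real ?(gtr0_real rho0) // => /ltW.
elim: (rs) far => [|t l IH] far; first by rewrite big_nil.
rewrite big_cons /= exprS; apply: ler_pM.
- exact: ltW.
- by apply: exprn_ge0; exact: ltW.
- exact/far/mem_head.
by apply: IH => t' t'l; apply: far; rewrite in_cons t'l orbT.
Qed.

(** No logarithm is used: the segment from 0 to x is cut into N equal steps, N independent of x,
    along which the successive ratios of f are close to 1. The product of their local roots is the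
    root, since the ratios telescope. *)
Lemma exists_continuous_root (K : set C) (f : C -> C) (d : nat) : (0 < d)%N ->
  compact K -> K 0 -> (forall x (t : R), K x -> 0 <= t <= 1 -> K (t%:C%C * x)) ->
  (forall a, K a -> f @ within K (nbhs a) --> f a) -> (forall x, K x -> f x != 0) ->
  exists g : C -> C, [/\ g 0 = 1, forall a, K a -> g @ within K (nbhs a) --> g a &
    forall x, K x -> f x = f 0 * g x ^+ d].
Proof.
move=> d0 Kc K0 Kstar fc f0.
have [eta eta0 [rt [rt1 rtP]]] := exists_local_root d0 (fun w rho => @exists_close_root d w rho d0).
have [M Mx] : exists M : R, forall x, K x -> Re `|x| < M.
  have [c cK cmax] : exists2 c, c \in K & forall t, t \in K -> Re `|t| <= Re `|c|.
    apply: compact_EVT_max => //; first by exists 0.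
    apply/subspace_continuousP => x _; apply: cvg_Re; apply: cvg_norm.
    exact: cvg_within.
  by exists (Re `|c| + 1) => x Kx; rewrite ltr_pwDr // cmax // inE.
have [e e0 eP] : exists2 e : R, 0 < e & forall x y, K x -> K y -> Re `|x - y| < e ->
    `|f y / f x - 1| < eta.
  (* Compactness in its near-covering form: a threshold [e] found near each point yields one valid
     on all of [K]. *)
  have : \forall e \near 0^'+, K `<=` (fun x => forall y, K x -> K y -> Re `|x - y| < e ->
      `|f y / f x - 1| < eta).
    apply: (compact_near_coveringP _).1 => // x0 Kx0.
    have ratioc : f p.2 / f p.1 @[p --> filter_prod (within K (nbhs x0)) (within K (nbhs x0))]
        --> f x0 / f x0.
      apply: cvgM; first by apply: (cvg_comp _ _ (@cvg_snd _ _ _ _ _)); exact: fc.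
      apply: cvgV; first exact: f0.
      by apply: (cvg_comp _ _ (@cvg_fst _ _ _ _ _)); exact: fc.
    rewrite divff ?f0 // in ratioc.
    have := (@cvgrPdist_lt _ _ _ _ _ _ _).1 ratioc _ eta0.
    move=> [[U V] /= [U1 V1] UV].
    have [r r0 rUV] : exists2 r : R, 0 < r & forall x, K x -> Re `|x0 - x| < r -> U x /\ V x.
      have : nbhs x0 [set x | K x -> U x /\ V x].
        have : within K (nbhs x0) (U `&` V) by exact: filterI.
        by [].
      move=> /nbhs_normP[r /= r0 rUV]; exists (Re r); first by move: r0; rewrite ltcE => /andP[].
      move=> x Kx xr; apply: rUV => //; rewrite /ball_ /= -[r](RRe_real (gtr0_real r0)).
      by rewrite normC_real ltcR.
    exists ([set x | Re `|x0 - x| < r / 2], [set e | e < r / 2]) => /=.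
      split.
        have r20 : 0 < r / 2 by rewrite divr_gt0.
        apply/nbhs_normP; exists (r / 2)%:C%C; rewrite /= ?ltcR // => x /=.
        by rewrite /ball_ /= normC_real ltcR.
      by apply: nbhs_right_lt; rewrite divr_gt0.
    move=> [x e] [] xr er y Kx Ky xye.
    have {}xr : Re `|x0 - x| < r / 2 := xr; have {}er : e < r / 2 := er.
    have [Ux _] : U x /\ V x by apply: rUV => //; move: xr; lra.
    have [_ Vy] : U y /\ V y.
      apply: rUV => //; have := ler_normD (x0 - x) (x - y).
      rewrite addrA subrK lecE complexReD => /andP[_ h].
      have xye' : Re `|x - y| < e := xye; move: xr er h xye'; lra.
    by have := UV (x, y) (conj Ux Vy); rewrite /= distrC.
  move=> H; have [e [e0 eP]] : exists e : R, 0 < e /\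
      K `<=` (fun x => forall y, K x -> K y -> Re `|x - y| < e -> `|f y / f x - 1| < eta).
    near (0 : R)^'+ => e; exists e; split; first by near: e; exact: nbhs_right_gt.
    by near: e.
  by exists e => // x y Kx; exact: (eP x Kx).
(* Norms on [K] are below M, so successive points of the subdivided segment are less than [e]
   apart. *)
pose N := (Num.bound (M / e)).+1.
have NM : M / e < N%:R.
  have M0 : 0 <= M by have := Mx 0 K0; rewrite normr0 => /ltW.
  have Me0 : 0 <= M / e by rewrite divr_ge0 // ltW.
  by rewrite (lt_le_trans (archi_boundP Me0)) // ler_nat.
have N0 : 0 < N%:R :> R by rewrite ltr0n.
pose s (j : nat) : C := (j%:R / N%:R : R)%:C%C.
have s01 j : (j <= N)%N -> 0 <= (j%:R / N%:R : R) <= 1.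
  by move=> jN; rewrite divr_ge0 //= ler_pdivrMr // mul1r ler_nat.
pose ratio j x := f (s j.+1 * x) / f (s j * x).
have sK j x : (j <= N)%N -> K x -> K (s j * x) by move=> jN Kx; apply: Kstar => //; exact: s01.
have ratio1 (j : 'I_N) x : K x -> `|ratio j x - 1| < eta.
  move=> Kx; apply: eP; [by apply: sK => //; exact: ltnW | exact: sK |].
  have -> : s j * x - s j.+1 * x = - ((N%:R^-1)%:C%C * x).
    by rewrite /s -natr1 mulrDl mul1r rmorphD mulrDl opprD addrA subrr sub0r.
  rewrite normrN normrM norm_complex_real [`|x|]normC_real -rmorphM.
  rewrite [Re _]/= ger0_norm ?invr_ge0 ?ltW //.
  by rewrite mulrC ltr_pdivrMr // mulrC -ltr_pdivrMr // (lt_trans _ NM) // ltr_pM2r ?invr_gt0 // Mx.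
exists (fun x => \prod_(j < N) rt (ratio j x)); split.
- rewrite big1 // => j _; rewrite /ratio !mulr0 divff ?f0 //.
- move=> a Ka; apply: cvg_prod_ord => j.
  have [_ rtc] := rtP _ (ratio1 j a Ka).
  apply: continuous_cvg; first exact: rtc.
  have fs i : (i <= N)%N -> f (s i * x) @[x --> within K (nbhs a)] --> f (s i * a).
    move=> iN; apply: (cvg_comp (fun x => s i * x) f); last exact/fc/sK.
    move=> A; rewrite /within /= => HA.
    have H : s i * x @[x --> within K (nbhs a)] --> s i * a.
      by apply: cvgM; [exact: cvg_cst | exact: cvg_within].
    have {}HA : nbhs a (fun x => K x -> K (s i * x) -> A (s i * x)) := H _ HA.
    suff : nbhs a (fun x => K x -> A (s i * x)) by [].
    by apply: filterS HA => x h Kx; apply: h => //; exact: sK.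
  apply: cvgM; first exact: fs.
  by apply: cvgV; [apply: f0; apply: sK => //; exact: ltnW | apply: fs; exact: ltnW].
- move=> x Kx; rewrite -prodrXl (eq_bigr (fun j : 'I_N => ratio j x)) => [|j _]; last first.
    by have [] := rtP _ (ratio1 j x Kx).
  rewrite (telescope_prodf (g := fun j => f (s j * x))); last first.
    by move=> n nN; apply: f0; exact: sK.
  rewrite /s divff ?gt_eqF // !mul0r mul1r mulrC divfK // f0 //.
Unshelve. all: by end_near.
Qed.
End ComplexPlane.

(** * Holomorphic motions *)

Section Motion.
Variable R : realType.
Local Notation C := (R[i] : numFieldType).
Local Notation Re := (@complex.Re R).

Lemma Re_norm_ge0 (x : C) : 0 <= Re `|x|.
Proof. by have := normr_ge0 x; rewrite lecE => /andP[]. Qed.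

Lemma Re_normD (x y : C) : Re `|x + y| <= Re `|x| + Re `|y|.
Proof. by have := ler_normD x y; rewrite lecE complexReD => /andP[]. Qed.

Lemma Re_normB (x y : C) : Re `|x - y| <= Re `|x| + Re `|y|.
Proof. by have := ler_normB x y; rewrite lecE complexReD => /andP[]. Qed.

Lemma Re_normM (x y : C) : Re `|x * y| = Re `|x| * Re `|y|.
Proof. by rewrite normrM {1}[`|x|]normC_real {1}[`|y|]normC_real -rmorphM. Qed.

Lemma Re_normX (x : C) n : Re `|x ^+ n| = Re `|x| ^+ n.
Proof.
elim: n => [|n IH]; first by rewrite !expr0 normr1.
by rewrite !exprS Re_normM IH.
Qed.

Lemma norm_square (r : R) (x : C) : square r x -> Re `|x| <= r + r.
Proof.
move=> [xr xi]; rewrite {1}(complexE x) (le_trans (Re_normD _ _)) // Re_normM.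
by rewrite norm_complexi !norm_complex_real mul1r lerD.
Qed.

Variables (d : nat) (c mu : C) (Z : seq C) (V : C -> C).
Let P (t : C) : C := t ^+ d + c.
Hypotheses (d_ge2 : (2 <= d)%N) (Zc : c \in Z) (ZP : forall a, a \in Z -> P a \in Z).
Hypotheses (VS : forall a, a \in Z -> mu * V (P a) = d%:R * a ^+ d.-1 * V a + mu * V c)
  (V0 : 0 \in Z -> V 0 = 0) (mu0 : mu != 0).

(* Bounded by M, and with velocity nu * V at time 0. *)
Definition motion (r M : R) (nu : C) (h : C -> C -> C) := forall a, a \in Z ->
  [/\ smooth (square r) (h a), h a 0 = a,
      (h a x - h a 0) / x @[x --> 0^'] --> nu * V a,
      forall x, square r x -> Re `|h a x| <= M &
      forall b x, b \in Z -> a != b -> square r x -> h a x != h b x].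

(** A motion involves no dynamics: the affine one has the required velocity, and the finitely many
    points of [Z] stay apart over a small square. *)
Lemma motion_init : exists2 r : R, 0 < r & exists2 M : R, 2 <= M & exists h, motion r M 1 h.
Proof.
pose h (a x : C) := a + V a * x.
have hE a : h a = horner (a%:P + V a *: 'X).
  by apply/funext => x; rewrite !hornerE.
have [r r0 rinj] : exists2 r : R, 0 < r & forall x, square r x -> forall i j : 'I_(size Z),
    Z`_i != Z`_j -> h Z`_i x != h Z`_j x.
  have near0 (o : C) : o = 0 ->
      \forall x \near o, forall i j : 'I_(size Z), Z`_i != Z`_j -> h Z`_i x != h Z`_j x.
    move=> o0; apply: (@filter_forall _ _ _ (nbhs o) (nbhs_filter o)) => i.
    apply: (@filter_forall _ _ _ (nbhs o) (nbhs_filter o)) => j.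
    have [->|ij] := eqVneq Z`_i Z`_j; first by near=> x.
    have := near_affine_neq (V Z`_i) (V Z`_j) ij; rewrite -o0.
    by apply: (@filterS _ (nbhs o) (nbhs_filter o)).
  have /(@nbhs_norm0P _ C _)[e /= e0 eP] := near0 0 erefl.
  have Re0 : 0 < Re e by move: e0; rewrite ltcE => /andP[].
  exists (Re e / 4%:R) => [|x xr]; first by rewrite divr_gt0.
  apply: eP => /=; rewrite -[e](RRe_real (gtr0_real e0)) normC_real ltcR.
  rewrite (le_lt_trans (norm_square xr)) // -mulrDl ltr_pdivrMr //; lra.
pose F a := Re `|a| + Re `|V a| * (r + r).
have F0 a : 0 <= F a by rewrite addr_ge0 ?mulr_ge0 ?Re_norm_ge0 // addr_ge0 // ltW.
(* The summand 2 secures M >= 2, on which the bound for lifted motions rests. *)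
exists r => //; exists (2 + \sum_(a <- Z) F a); first by rewrite lerDl sumr_ge0.
exists h => a aZ; split.
- by rewrite hE; exact: smooth_horner.
- by rewrite /h mulr0 addr0.
- rewrite mul1r; have : cst (V a) x @[x --> (0 : C)^'] --> V a by exact: cvg_cst.
  apply: cvg_trans; apply: near_eq_cvg; near=> x.
  have x0 : x != 0 by near: x; exact: nbhs_dnbhs_neq.
  by rewrite /h mulr0 addr0 addrC addKr mulfK.
- move=> x xr; apply: (@le_trans _ _ (F a)).
    rewrite /h (le_trans (Re_normD _ _)) // lerD2l Re_normM ler_wpM2l ?Re_norm_ge0 //.
    exact: norm_square.
  rewrite (big_rem a aZ) /= addrCA lerDl addr_ge0 ?sumr_ge0 //.
- move=> b x bZ ab xr; move: aZ bZ ab => /(nthP 0)[i iZ <-] /(nthP 0)[j jZ <-] ij.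
  exact: (rinj x xr (Ordinal iZ) (Ordinal jZ)).
Unshelve. all: by end_near.
Qed.

(* h' solves (h' a) ^+ d = h (P a) - h c; points never collide, so for a != 0 the
   right hand side has no zero and a continuous root exists over the square. *)
Lemma motion_lift r M nu h : 0 < r -> 2 <= M -> motion r M nu h ->
  exists h', motion r M (nu / mu) h'.
Proof.
move=> r0 M2 hm.
have d0 : (0 < d)%N by exact: ltnW.
have K0 : nbhs (0 : C) (square r) by apply: square_nbhs; rewrite normr0.
have K00 := nbhs_singleton K0.
have Kstar x (t : R) : square r x -> 0 <= t <= 1 -> square r (t%:C%C * x).
  move=> [xr xi] /andP[t0 t1].
  split; rewrite ?complexReM ?complexImM /= mul0r ?subr0 ?addr0 normrM ger0_norm //.
    by rewrite (le_trans _ xr) // ler_piMl.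
  by rewrite (le_trans _ xi) // ler_piMl.
have [G GP] : exists G : C -> C -> C, forall p, p \in Z -> p != c ->
    [/\ G p 0 = 1, forall a, square r a -> G p @ within (square r) (nbhs a) --> G p a &
      forall x, square r x -> h p x - h c x = (p - c) * G p x ^+ d].
  suff /choice[G GP] : forall p, exists g : C -> C, p \in Z -> p != c ->
    [/\ g 0 = 1, forall a, square r a -> g @ within (square r) (nbhs a) --> g a &
      forall x, square r x -> h p x - h c x = (p - c) * g x ^+ d] by exists G.
  move=> p; have [pZ|] := boolP (p \in Z); last by exists id.
  have [->|pc] := eqVneq p c; first by exists id.
  have [ps p0 _ _ pinj] := hm p pZ; have [cs c0 _ _ _] := hm c Zc.
  have f0 x : square r x -> h p x - h c x != 0.
    by move=> Kx; rewrite subr_eq0; exact: pinj.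
  have fc a : square r a -> h p x - h c x @[x --> within (square r) (nbhs a)] --> h p a - h c a.
    by move=> Ka; exact: (smooth_cvg (smoothB ps cs)).
  have [g [g0 gc gE]] := exists_continuous_root d0 (@compact_square R r) K00 Kstar fc f0.
  by exists g => _ _; split => // x Kx; rewrite gE // p0 c0.
(* The root depends on [P a] alone: preimages of one point move as multiples of a single
   nonvanishing function, hence never meet. The critical point 0 stays fixed. *)
pose h' a x := a * G (P a) x.
have h'X a x : a \in Z -> square r x -> h' a x ^+ d = h (P a) x - h c x.
  move=> aZ Kx; have [->|a0] := eqVneq a 0.
    by rewrite /h' mul0r /P expr0n eqn0Ngt d0 /= add0r subrr.
  have Pc : P a != c by rewrite -subr_eq0 /P addrK expf_neq0.
  have [_ _ ->] := GP _ (ZP aZ) Pc => //.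
  by rewrite /P addrK exprMn.
have h'00 a : a \in Z -> h' a 0 = a.
  move=> aZ; have [->|a0] := eqVneq a 0; first by rewrite /h' mul0r.
  have Pc : P a != c by rewrite -subr_eq0 /P addrK expf_neq0.
  by have [G0 _ _] := GP _ (ZP aZ) Pc; rewrite /h' G0 mulr1.
have h'0 x : h' 0 x = 0 by rewrite /h' mul0r.
have h's a : a \in Z -> a != 0 -> smooth (square r) (h' a).
  move=> aZ a0; have Pc : P a != c by rewrite -subr_eq0 /P addrK expf_neq0.
  have [_ Gc _] := GP _ (ZP aZ) Pc.
  have [Ps _ _ _ Pinj] := hm _ (ZP aZ); have [cs _ _ _ _] := hm c Zc.
  apply: (smooth_root d0 (smoothB Ps cs)).
  - by move=> b Kb; apply: cvgM; [exact: cvg_cst | exact: Gc].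
  - by move=> x Kx; exact: h'X.
  - by move=> x Kx; rewrite subr_eq0; exact: Pinj.
exists h' => a aZ; split.
- have [->|a0] := eqVneq a 0; last exact: h's.
  have -> : h' 0 = horner 0 by apply/funext => x; rewrite h'0 horner0.
  exact: smooth_horner.
- exact: h'00.
- have [a0|a0] := eqVneq a 0.
    rewrite a0 in aZ *; rewrite V0 // mulr0; under eq_fun do rewrite !h'0 subrr mul0r.
    exact: cvg_cst.
  have [Ps P0 Pd _ Pinj] := hm _ (ZP aZ); have [cs c0 cd _ _] := hm c Zc.
  (* The eigenvector equation [VS], rewritten as the derivative at time 0 of h' ^ d = h (P a) - h c;
     this is where the velocity gets divided by mu. *)
  have -> : nu / mu * V a = (nu * V (P a) - nu * V c) / (d%:R * h' a 0 ^+ d.-1).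
    rewrite h'00 //; have cof0 : d%:R * a ^+ d.-1 != 0 :> C.
      by rewrite mulf_neq0 ?expf_neq0 // pnatr_eq0 -lt0n.
    apply: (mulIf cof0); rewrite divfK // -mulrBr.
    have -> : V (P a) - V c = mu^-1 * (d%:R * a ^+ d.-1 * V a).
      by apply: (mulfI mu0); rewrite mulVKf // mulrBr VS // addrK.
    by ring.
  apply: (@cvg_slope_root C d (fun x => h (P a) x - h c x) (h' a) (nu * V (P a) - nu * V c) d0).
  - by rewrite h'00.
  - exact: h'X.
  - apply: nbhs_dnbhs; apply: (@filterS _ (nbhs (0 : C)) (nbhs_filter _)) K0.
    by move=> x Kx; exact: h'X.
  - have := smooth_cvg (h's a aZ a0) K00 => H A /H/(near_interior K0)/nbhs_dnbhs.
    exact.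
  - exact: (cvg_slopeB Pd cd).
- move=> x Kx; have [_ _ _ PM _] := hm _ (ZP aZ); have [_ _ _ cM _] := hm c Zc.
  rewrite leNgt; apply/negP => hM.
  (* A norm above M >= 2 would have its d-th power at least its square, hence above 2 M. *)
  have : Re `|h' a x| ^+ d <= M + M.
    rewrite -Re_normX h'X // (le_trans (Re_normB _ _)) // lerD //; [exact: PM | exact: cM].
  have M1 : 1 <= Re `|h' a x| by rewrite (le_trans _ (ltW hM)) // (le_trans _ M2) // ler1n.
  move=> /(le_trans (ler_weXn2l M1 d_ge2)); apply/negP; rewrite -ltNge -mulr2n -mulr_natl.
  rewrite expr2 ltr_pM //; first exact: le_trans M2.
  exact: le_lt_trans M2 hM.
- move=> b x bZ ab Kx; apply/negP => /eqP hab.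
  have hPP : h (P a) x = h (P b) x.
    by apply: (addIr (- h c x)); rewrite -!h'X // hab.
  have PP : P a = P b.
    apply/eqP/negPn/negP => PP; have [_ _ _ _ Pinj] := hm _ (ZP aZ).
    by have := Pinj _ _ (ZP bZ) PP Kx; rewrite hPP eqxx.
  have abd : a ^+ d = b ^+ d by move: PP; rewrite /P => /addIr.
  have [a0|a0] := eqVneq a 0.
    move: abd; rewrite a0 expr0n eqn0Ngt d0 /= => /esym/eqP.
    by rewrite expf_eq0 d0 /= => /eqP b0; move: ab; rewrite a0 b0 eqxx.
  have Pc : P a != c by rewrite -subr_eq0 /P addrK expf_neq0.
  have GPa : G (P a) x != 0.
    have [_ _ _ _ Pinj] := hm _ (ZP aZ); have := Pinj _ _ Zc Pc Kx.
    rewrite -subr_eq0; have [_ _ ->] := GP _ (ZP aZ) Pc => //.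
    by rewrite mulf_eq0 expf_eq0 d0 /= negb_or => /andP[].
  move: hab; rewrite /h' -PP => /(mulIf GPa) ab'.
  by move: ab; rewrite ab' eqxx.
Unshelve. all: by end_near.
Qed.

Lemma motion_eigenvalue_norm_ge1 a : a \in Z -> V a != 0 -> 1 <= Re `|mu|.
Proof.
move=> aZ Va.
have [r r0 [M M2 [h0 h0m]]] := motion_init.
have hn n : exists h, motion r M (mu^-1 ^+ n) h.
  elim: n => [|n [h hm]]; first by exists h0.
  by rewrite exprSr; exact: motion_lift hm.
have bound n : Re `|mu^-1 ^+ n * V a| <= 2 * M / r.
  have [h hm] := hn n; have [hs ha hd hM _] := hm a aZ.
  exact: cauchy_estimate hd hM.
rewrite leNgt; apply/negP => mu1.
have Va0 : 0 < Re `|V a| by have := normr_gt0 (V a); rewrite Va ltcE => /andP[].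
have Mr0 : 0 < 2 * M / r by rewrite divr_gt0 // mulr_gt0 // (lt_le_trans _ M2).
have : (Re `|mu|) ^+ n @[n --> \oo] --> 0.
  by apply: cvg_expr; rewrite ger0_norm // Re_norm_ge0.
move/cvgrPdist_lt => /(_ (Re `|V a| / (2 * M / r))) /(_ (divr_gt0 Va0 Mr0)).
move=> [n _ /(_ n (leqnn n))] /=.
rewrite sub0r normrN ger0_norm ?exprn_ge0 ?Re_norm_ge0 // ltr_pdivlMr // => h.
have {}h : Re `|mu| ^+ n * (2 * M / r) < Re `|V a| := h.
have mun : 0 < Re `|mu| ^+ n.
  by rewrite exprn_gt0 //; have := normr_gt0 mu; rewrite mu0 ltcE => /andP[].
have := bound n; rewrite -(ler_pM2l mun) -{1}Re_normX -Re_normM mulrA exprVn.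
rewrite mulfV ?expf_neq0 // mul1r => h'.
by move: (le_lt_trans h' h); rewrite ltxx.
Qed.
End Motion.

(** * Coordinates on M and the derivative of F *)

Section Differential.
Variables (K : numFieldType) (V W : normedModType K).

Lemma continuous_linear_lipschitz (l : {linear V -> K}) (c : nat) :
  (forall x, `|l x| <= c%:R * `|x|) -> continuous l.
Proof.
move=> lx; apply/bounded_linear_continuous/linear_boundedP.
near=> r; move=> x; have cr : c%:R <= r by near: r; exact: nbhs_pinfty_ge.
by rewrite (le_trans (lx x)) // ler_wpM2r.
Unshelve. all: by end_near.
Qed.

Lemma differentiable_finite_expansion n (f : V -> W) (c : 'I_n -> V -> K)
    (b : 'I_n -> W) x : (forall y, f y = \sum_(i < n) c i y *: b i) ->
  (forall i, differentiable (c i) x) -> differentiable f x.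
Proof.
move=> fE cd; have -> : f = \sum_(i < n) (fun y => c i y *: b i).
  by apply/funext => y; rewrite fE fct_sumE.
by apply: differentiable_sum => i; exact: differentiableZl.
Qed.

Lemma differentiable_exp (f : V -> K) n x :
  differentiable f x -> differentiable (fun y => f y ^+ n) x.
Proof.
case: n => [|n] fd; first exact: differentiable_cst.
by have := differentiableX n fd; rewrite exprfctE.
Qed.

Lemma differentiable_lin2 (f g : V -> K) a b x : differentiable f x ->
  differentiable g x -> differentiable (fun y => a * f y + b * g y) x.
Proof.
move=> fd gd; have := differentiableD (differentiableZ a fd) (differentiableZ b gd).
exact.
Qed.

(** The differential is read through linear forms: a form [l] that turns [f] into a d-th power of
    another form is handled by the chain rule, with no global formula for [f]. *)
Lemma diff_linear_power (d : nat) (d0 : (0 < d)%N) (f : V -> V) (l l' : {linear V -> K}) z v :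
  continuous l -> continuous l' -> differentiable f z ->
  (forall x, l (f x) = l' x ^+ d) ->
  l ('d f z v) = d%:R * l' z ^+ d.-1 * l' v.
Proof.
move=> lc l'c fd lf.
have E1 : 'd (l \o f) z v = l ('d f z v).
  by rewrite diff_comp //; [rewrite /= (diff_lin _ lc) | exact: linear_differentiable].
have E2 : 'd ((l' : V -> K) ^+ d) z v = d%:R * l' z ^+ d.-1 * l' v.
  case: (d) d0 => // n _; rewrite diffX; last exact: linear_differentiable.
  by rewrite /= (diff_lin _ l'c).
rewrite -E1 -E2; congr ('d _ z v); apply/funext => x /=; rewrite lf.
by rewrite exprfctE.
Qed.
End Differential.

Section EventuallyPeriodic.
Variables (T : Type) (x : nat -> T).

Lemma eventually_periodic_mul k m q i : eventually_periodic x k m -> (k < i)%N ->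
  x (i + q * m)%N = x i.
Proof.
move=> xP ki; elim: q => [|q IH]; first by rewrite mul0n addn0.
by rewrite mulSn addnCA addnC xP // ltn_addr.
Qed.

(** Beyond k, the representative of j modulo m among k + 1, ..., k + m. *)
Definition reduce k m j := if (j <= k)%N then j else (k.+1 + (j - k.+1) %% m)%N.

Lemma eventually_periodic_reduce k m j : eventually_periodic x k m ->
  x j = x (reduce k m j).
Proof.
move=> xP; rewrite /reduce; case: (leqP j k) => // kj.
rewrite -[in LHS](subnKC kj) {1}(divn_eq (j - k.+1) m) [(_ * m + _)%N]addnC addnA.
by rewrite (eventually_periodic_mul _ xP) // ltn_addr.
Qed.

Lemma reduce_le k m j : (0 < m)%N -> (reduce k m j <= k + m)%N.
Proof.
move=> m0; rewrite /reduce; case: (leqP j k) => [jk|kj]; first exact: leq_trans jk (leq_addr _ _).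
by rewrite addSn -addnS leq_add2l ltn_mod.
Qed.

Lemma reduceD k m j : (k < j)%N -> reduce k m (j + m) = reduce k m j.
Proof.
move=> kj; rewrite /reduce [(j + m <= k)%N]leqNgt [(j <= k)%N]leqNgt kj (ltn_addr _ kj) /=.
by rewrite -addnBAC // modnDr.
Qed.

Lemma reduce_small k m j : (j <= k + m)%N -> reduce k m j = j.
Proof.
rewrite /reduce; case: (leqP j k) => // kj jm.
by rewrite modn_small ?subnKC // ltn_subLR // addSn ltnS.
Qed.

(** A positive remainder of m modulo m' would be a period smaller than m'. *)
Lemma eventually_periodic_dvdn k m k' (m' : posnat) : preperiod_period x k' m' ->
  (0 < m)%N -> eventually_periodic x k m -> (k' <= k)%N /\ (m' %| m)%N.
Proof.
move=> [xP' xmin] m0 xP; have [kk _] := xmin k (PosNat m0) xP; split => //.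
rewrite /dvdn eqn0Ngt; apply/negP => r0.
have [|_] := xmin k (PosNat r0); last first.
  by rewrite /= leqNgt ltn_mod posnat_gt0.
move=> i ki /=; rewrite -[in RHS]xP // [in RHS](divn_eq m m') [in RHS]addnCA.
rewrite [in RHS]addnC.
by rewrite (eventually_periodic_mul _ xP') // (leq_ltn_trans kk) // ltn_addr.
Qed.

End EventuallyPeriodic.

Section Coordinates.
Variables (R : realType) (beta : R[i]) (k : nat) (m : posnat).
Hypothesis beta0 : beta != 0.
Local Notation M := (M beta k m).
Local Notation n := (k + m - 1)%N.

Lemma M0 (x : M) : x 0%N = 0. Proof. by have /MpredP[] := MseqP x. Qed.

Lemma M_periodic (x : M) : eventually_periodic x k m.
Proof. by have /MpredP[] := MseqP x. Qed.

Lemma M_boundary (x : M) : x k = beta * x (k + m)%N.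
Proof.
by have /MpredP[_ _ /eqP] := MseqP x; rewrite subr_eq0 => /eqP.
Qed.

Definition Mcoord j (x : M) : R[i]^o := x j.

Lemma Mcoord_linear j : linear (Mcoord j). Proof. by []. Qed.
HB.instance Definition _ j := GRing.isLinear.Build _ _ _ _ (Mcoord j) (@Mcoord_linear j).

Lemma Mcoord_le_norm j (x : M) : `|Mcoord j x| <= `|x|.
Proof.
rewrite /Mcoord (eventually_periodic_reduce j (@M_periodic x)).
have jl : (reduce k m j < (k + m).+1)%N by rewrite ltnS reduce_le // posnat_gt0.
rewrite [`|x|]/Num.norm /= /Mnorm (bigD1 (Ordinal jl)) //= lerDl.
by apply: sumr_ge0 => i _; exact: normr_ge0.
Qed.

(** Periodicity leaves the indices up to k + m, and the last value follows from the boundary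
    condition because beta is nonzero. *)
Lemma M_ext (x y : M) : (forall j, (0 < j <= n)%N -> x j = y j) -> x = y.
Proof.
move=> xy; apply: val_inj; apply/funext => j /=.
have m0 := posnat_gt0 m.
have {}xy i : (i < k + m)%N -> x i = y i.
  by case: i => [|i] ik; [rewrite !M0 | apply: xy; lia].
have xym : x (k + m)%N = y (k + m)%N.
  by apply: (mulfI beta0); rewrite -!M_boundary xy //; lia.
rewrite (eventually_periodic_reduce j (@M_periodic x)).
rewrite (eventually_periodic_reduce j (@M_periodic y)).
have := reduce_le k j m0; rewrite leq_eqVlt => /orP[/eqP -> //|]; exact: xy.
Qed.

(** The value on the class of k + m is dictated by the boundary condition, hence the division by
    beta. *)
Definition extend (w : nat -> R[i]) (j : nat) : R[i]^o :=
  if (j <= k)%N then w j else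
  if reduce k m j == (k + m)%N then w k / beta else w (reduce k m j).

Lemma extendE w j : (j <= n)%N -> extend w j = w j.
Proof.
have m0 := posnat_gt0 m; move=> jn; rewrite /extend; case: (leqP j k) => // kj.
rewrite reduce_small; last by lia.
by case: eqP => //; lia.
Qed.

Lemma extend_in w : w 0%N = 0 -> extend w \in Mpred beta k m.
Proof.
have m0 := posnat_gt0 m; move=> w0; apply/MpredP; split.
- by rewrite /extend.
- move=> i ki; rewrite /extend [(i + m <= k)%N]leqNgt [(i <= k)%N]leqNgt ki.
  by rewrite (ltn_addr _ ki) /= reduceD.
- rewrite /extend leqnn reduce_small // eqxx ifF; last by lia.
  by rewrite mulrC divfK // subrr.
Qed.

(* Only the values of w at 1, ..., k + m - 1 matter. *)
Definition ofcoords (w : nat -> R[i]) : M :=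
  insubd (0 : M) (extend (fun j => if j is 0 then 0 else w j)).

Lemma ofcoordsE w j : (0 < j <= n)%N -> ofcoords w j = w j.
Proof.
case: j => // j jn; rewrite /ofcoords insubdK ?extendE //.
exact: extend_in.
Qed.

Definition Mbasis (i : 'I_n) : M := ofcoords (fun j => (j == i.+1)%:R).

Lemma Mcoord_sum r (F : 'I_r -> M) j : (\sum_(i < r) F i) j = \sum_(i < r) F i j.
Proof. by rewrite -/(Mcoord j _) linear_sum. Qed.

Lemma McoordZ (a : R[i]) (x : M) j : (a *: x) j = a * x j. Proof. by []. Qed.

Lemma M_expand (x : M) : x = \sum_(i < n) x i.+1 *: Mbasis i.
Proof.
apply: M_ext => j jn; rewrite Mcoord_sum.
have jn' : (j.-1 < n)%N by lia.
rewrite (bigD1 (Ordinal jn')) //; rewrite big1 => [|i ij].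
  have E : (Ordinal jn').+1 = j by rewrite /= prednK //; case/andP: jn.
  by rewrite McoordZ ofcoordsE // E eqxx mulr1 Monoid.mulm1.
rewrite McoordZ ofcoordsE // (_ : _ == _ = false) ?mulr0 //.
by apply/eqP => ji; move: ij; rewrite -val_eqE /= ji /= eqxx.
Qed.

Lemma Mcoord_continuous j : continuous (Mcoord j).
Proof.
by apply: (@continuous_linear_lipschitz _ _ _ 1) => x; rewrite mul1r; exact: Mcoord_le_norm.
Qed.

Lemma Mcoord_differentiable j x : differentiable (Mcoord j) x.
Proof. exact/linear_differentiable/Mcoord_continuous. Qed.

End Coordinates.

Section Dynamics.
Variables (R : realType) (d : nat) (beta : R[i]).
Hypotheses (d_ge2 : (2 <= d)%N) (beta_root : beta ^+ d = 1) (beta_neq1 : beta != 1).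
Local Notation C := (R[i] : numFieldType).
Local Notation F := (Fmap d_ge2 beta_root beta_neq1).

Let d_gt0 : (0 < d)%N. Proof. exact: ltnW. Qed.

Lemma unity_root_neq0 : beta != 0.
Proof.
apply/eqP => b0; move: beta_root; rewrite b0 expr0n eqn0Ngt d_gt0.
by move/esym/eqP; rewrite oner_eq0.
Qed.

Lemma FmapS k m (x : M beta k m) j : F k m x j.+1 = x j ^+ d + F k m x 1%N.
Proof. by apply: FseqS => //; exact: M0. Qed.

Lemma Fmap1 k m (x : M beta k m) : F k m x 1%N =
  if k is k1.+1
  then - ((beta * x (k + m - 1)%N ^+ d - x k1 ^+ d) / (beta - 1))
  else - x (m - 1)%N ^+ d.
Proof. by []. Qed.

Lemma Mcoord_exp_differentiable k m j (x : M beta k m) :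
  differentiable (fun y : M beta k m => Mcoord j y ^+ d : C) x.
Proof.
exact/differentiable_exp/Mcoord_differentiable.
Qed.

Lemma Fmap_differentiable k m (x : M beta k m) : differentiable (F k m) x.
Proof.
apply: (@differentiable_finite_expansion _ _ _ (k + m - 1) _
  (fun i y => F k m y i.+1 : C) (@Mbasis R beta k m)).
  by move=> y; exact: (M_expand unity_root_neq0).
have F1 : differentiable (fun y : M beta k m => F k m y 1%N : C) x.
  have [b1 [b2 [j1 [j2 FE]]]] : exists b1 b2 j1 j2, forall y : M beta k m,
      F k m y 1%N = b1 * y j1 ^+ d + b2 * y j2 ^+ d.
    case: k x => [|k1] _; last first.
      exists (- (beta / (beta - 1))), (beta - 1)^-1, (k1.+1 + m - 1)%N, k1 => y.
      by rewrite Fmap1; ring.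
    by exists (-1), 0, (m - 1)%N, 0%N => y; rewrite Fmap1; ring.
  under eq_fun do rewrite FE.
  by apply: differentiable_lin2; exact: Mcoord_exp_differentiable.
move=> i.
have -> : (fun y => F k m y i.+1 : C) = (fun y => 1 * Mcoord i y ^+ d + 1 * F k m y 1%N).
  by apply/funext => y; rewrite FmapS !mul1r.
by apply: differentiable_lin2 => //; exact: Mcoord_exp_differentiable.
Qed.

(** The form x_(j+1) - x_1 turns F into the d-th power of x_j, the unknown first coordinate
    cancelling. *)
Lemma diff_FmapS k m (z v : M beta k m) j :
  ('d (F k m) z v) j.+1 = d%:R * z j ^+ d.-1 * v j + ('d (F k m) z v) 1%N.
Proof.
have lin : linear (fun x : M beta k m => Mcoord j.+1 x - Mcoord 1%N x : R[i]^o).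
  move=> a x y.
  transitivity ((a * x j.+1 + y j.+1) - (a * x 1%N + y 1%N) : R[i]); first by [].
  by transitivity (a * (x j.+1 - x 1%N) + (y j.+1 - y 1%N) : R[i]); first by ring.
pose lM := GRing.isLinear.Build _ _ _ _ _ lin.
pose l : {linear M beta k m -> R[i]^o} :=
  HB.pack (fun x : M beta k m => Mcoord j.+1 x - Mcoord 1%N x : R[i]^o) lM.
have lc : continuous l.
  apply: (@continuous_linear_lipschitz _ _ _ 2) => x; rewrite mulr_natl mulr2n.
  by rewrite (le_trans (ler_normB _ _)) // lerD // Mcoord_le_norm.
have := @diff_linear_power _ _ d d_gt0 (F k m) l (Mcoord j) z v lc (@Mcoord_continuous R beta k m j)
  (Fmap_differentiable z).
rewrite -[l _]/(('d (F k m) z v) j.+1 - ('d (F k m) z v) 1%N : R[i]) => <-.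
  by rewrite subrK.
by move=> x; rewrite [l _]/(F k m x j.+1 - F k m x 1%N : R[i]) [F k m x j.+1]FmapS; exact: addrK.
Qed.

(** * Conjugacy with Koch's maps *)

Lemma entryE n (y : 'rV[R[i]]_n) (i : 'I_n) : entry y i.+1 = y 0 i.
Proof. by rewrite /entry insubT //= => ltn; congr (y _ _); exact: val_inj. Qed.

Lemma entry_differentiable n j (y : 'rV[C]_n) :
  differentiable (fun u : 'rV[C]_n => entry u j : C) y.
Proof.
case: j => [|j]; first exact: differentiable_cst.
rewrite /entry; case: insubP => [ i _ _ | _ ]; last exact: differentiable_cst.
exact: differentiable_coord.
Qed.

Lemma holomorphic_row k m n (c : 'I_n -> M beta k m -> C) :
  (forall i x, differentiable (c i) x) ->
  holomorphic (fun x => \row_i c i x : 'rV[C]_n).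
Proof.
move=> cd x; apply: (@differentiable_finite_expansion _ _ _ n _ c
  (fun i => delta_mx 0 i : 'rV[C]_n)) => // y.
by rewrite [LHS]row_sum_delta; apply: eq_bigr => i _; rewrite mxE.
Qed.

Lemma holomorphic_ofcoords k m n (w : nat -> 'rV[C]_n -> C) :
  (forall j y, differentiable (w j) y) ->
  holomorphic (fun y => ofcoords beta k m (w ^~ y)).
Proof.
move=> wd x; apply: (@differentiable_finite_expansion _ _ _ (k + m - 1) _
  (fun i => w i.+1) (@Mbasis R beta k m)) => // y.
rewrite [LHS](M_expand unity_root_neq0); apply: eq_bigr => i _.
by rewrite (ofcoordsE unity_root_neq0) //=.
Qed.

(** For k = 0 the two maps already coincide in the coordinates x_1, ..., x_(m-1). *)
Lemma conjugate_periodic m : holomorphically_conjugate (F 0 m) (Gmap d beta 0 m).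
Proof.
have m0 := posnat_gt0 m.
exists (fun x : M beta 0 m => \row_(i < 0 + m - 1) (x i.+1 : R[i])),
  (fun y => ofcoords beta 0 m (entry y)); split.
- move=> x; apply: (M_ext unity_root_neq0) => j jn; rewrite (ofcoordsE unity_root_neq0) //.
  case: j jn => // j jn; rewrite (entryE _ (Ordinal jn)) mxE //.
- move=> y; apply/rowP => i; rewrite mxE (ofcoordsE unity_root_neq0) ?entryE //=.
- by apply: holomorphic_row => i x; exact: Mcoord_differentiable.
- by apply: holomorphic_ofcoords => j y; exact: entry_differentiable.
move=> x; apply/rowP => i; rewrite !mxE.
have entx j : (j < m)%N -> entry (\row_(i0 < 0 + m - 1) (x i0.+1 : R[i])) j = x j.
  case: j => [|j] jm; first by rewrite /entry M0.
  have jn : (j < 0 + m - 1)%N by lia.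
  by rewrite (entryE _ (Ordinal jn)) mxE.
have im : (i < m)%N by have := ltn_ord i; lia.
have im1 : (m - 1 < m)%N by lia.
by rewrite (entx _ im) (entx _ im1) FmapS Fmap1.
Qed.

(* With L the linear map such that F = L \o pow and G = pow \o L in coordinates,
   the conjugacy is the inverse of L: x |-> (x_(i+1) - x_1)_i. *)
Lemma conjugate_preperiodic k m :
  holomorphically_conjugate (F k.+1 m) (Gmap d beta k.+1 m).
Proof.
have m0 := posnat_gt0 m; have b0 := unity_root_neq0.
have b1 : beta - 1 != 0 by rewrite subr_eq0.
pose n := (k.+1 + m - 1)%N.
(* The coordinate x_1 lost in the differences y_i = x_(i+1) - x_1 is recovered from the boundary
   condition: (beta - 1) x_1 = - (beta y_n - y_k). *)
pose x1 (y : 'rV[C]_n) := - ((beta * entry y n - entry y k) / (beta - 1)).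
pose w (j : nat) y := entry y j.-1 + x1 y.
have entx (x : M beta k.+1 m) j : (j <= n)%N ->
    entry (\row_(i < n) (x i.+2 - x 1%N)) j = x j.+1 - x 1%N.
  case: j => [|j] jn; first by rewrite subrr.
  by rewrite (entryE _ (Ordinal jn)) mxE.
have nE : n.+1 = (k.+1 + m)%N by rewrite /n; lia.
have kn : (k <= n)%N by rewrite /n; lia.
have x1E (x : M beta k.+1 m) : x1 (\row_(i < n) (x i.+2 - x 1%N)) = x 1%N.
  rewrite /x1 !entx // nE [x k.+1](M_boundary x).
  have -> : beta * (x (k.+1 + m)%N - x 1%N) - (beta * x (k.+1 + m)%N - x 1%N)
    = - ((beta - 1) * x 1%N) by ring.
  by rewrite mulNr opprK mulrAC divff // mul1r.
exists (fun x : M beta k.+1 m => \row_(i < n) (x i.+2 - x 1%N)),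
  (fun y => ofcoords beta k.+1 m (w ^~ y)); split.
- move=> x; apply: (M_ext b0) => j jn; rewrite (ofcoordsE b0) // /w x1E.
  case: j jn => // j jn; rewrite entx ?subrK //; move: jn; rewrite /n; lia.
- move=> y; apply/rowP => i; rewrite mxE.
  have w1 : ofcoords beta k.+1 m (w ^~ y) 1%N = x1 y.
    rewrite (ofcoordsE b0) ///w ?add0r //; lia.
  rewrite w1; have [ilt|ige] := ltnP i.+1 n.
    by rewrite (ofcoordsE b0) // /w -pred_Sn addrK entryE.
  (* The last entry involves x_(n+1), which is not a free coordinate and is reached through the
     boundary condition. *)
  have iE : i.+1 = n by apply/eqP; rewrite eqn_leq ige ltn_ord.
  rewrite iE -entryE iE nE; apply: (mulfI b0); rewrite mulrBr -M_boundary.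
  rewrite (ofcoordsE b0) // ?/w; last by lia.
  by rewrite /x1 /=; field.
- apply: (@holomorphic_row _ _ _ (fun (i : 'I_n) x => x i.+2 - x 1%N : C)) => i x.
  have -> : (fun x : M beta k.+1 m => x i.+2 - x 1%N : C)
      = (fun x => 1 * Mcoord i.+2 x + (-1) * Mcoord 1 x).
    by apply/funext => u; rewrite mul1r mulN1r.
  by apply: differentiable_lin2; exact: Mcoord_differentiable.
- apply: (@holomorphic_ofcoords _ _ _ (w : nat -> 'rV[C]_n -> C)) => j y.
  have -> : (w j : 'rV[C]_n -> C) = (fun y => 1 * entry y j.-1 + 1 * (
      - (beta / (beta - 1)) * entry y n + (beta - 1)^-1 * entry y k)).
    by apply/funext => u; rewrite /w /x1; ring.
  apply: differentiable_lin2; first exact: entry_differentiable.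
  by apply: differentiable_lin2; exact: entry_differentiable.
move=> x; apply/rowP => i; rewrite !mxE.
have E := x1E x; rewrite /x1 in E; rewrite E.
have iltn : (i <= n)%N by exact/ltnW/ltn_ord.
rewrite entx // subrK [F _ _ x i.+2]FmapS; exact: addrK.
Qed.

Lemma Fmap_conjugate_Gmap k m : holomorphically_conjugate (F k m) (Gmap d beta k m).
Proof. by case: k => [|k]; [exact: conjugate_periodic | exact: conjugate_preperiodic]. Qed.
End Dynamics.

(** * Eigenvalues at the critical orbit *)

Lemma reduce_gt0 k m j : (0 < j)%N -> (0 < reduce k m j)%N.
Proof. by rewrite /reduce; case: ifP. Qed.

Section CriticalOrbit.
Variables (R : realType) (d : nat) (z : nat -> R[i]).
Hypotheses (d_ge2 : (2 <= d)%N) (z0 : z 0%N = 0)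
  (zS : forall j, z j.+1 = z j ^+ d + z 1%N).
Variables (k : nat) (m : posnat).
Hypothesis z_preper : preperiod_period z k m.

Let d_gt0 : (0 < d)%N. Proof. exact: ltnW. Qed.
Let z_per : eventually_periodic z k m. Proof. by case: z_preper. Qed.

Lemma orbit_shift i j t : z i = z j -> z (i + t)%N = z (j + t)%N.
Proof.
by move=> ij; elim: t => [|t IH]; rewrite ?addn0 // !addnS [LHS]zS [RHS]zS IH.
Qed.

(** The orbit is deterministic: one coincidence gives period j - i after i - 1, to which minimality
    of (k, m) applies. *)
Lemma orbit_eq i j : (0 < i < j)%N -> z i = z j -> (k < i)%N /\ (m %| j - i)%N.
Proof.
move=> /andP[i0 ij] zij.
have zP : eventually_periodic z i.-1 (j - i).
  move=> t it; have -> : t = (i + (t - i))%N by lia.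
  by rewrite addnAC subnKC ?(ltnW ij) // (orbit_shift _ (esym zij)).
have [] := eventually_periodic_dvdn z_preper _ zP; first by rewrite subn_gt0.
by move=> ki ->; split => //; lia.
Qed.

(** A return to the critical point 0 gives z_(i+1) = z_1, a coincidence at the first index. *)
Lemma orbit_zero i : (0 < i)%N -> z i = 0 -> k = 0%N /\ (m %| i)%N.
Proof.
move=> i0 zi; have z1 : z 1%N = z i.+1 by rewrite [RHS]zS zi expr0n eqn0Ngt d_gt0 add0r.
by have [|k1] := orbit_eq _ z1; [lia | rewrite subn1 => mi; split => //; lia].
Qed.

Lemma orbit_period_zero i : k = 0%N -> (m %| i)%N -> z i = 0.
Proof.
move=> k0 /dvdnP[q ->]; have m0 := posnat_gt0 m.
have zm : z m = 0.
  have : z m.+1 = z 1%N by rewrite -addn1 addnC z_per // k0.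
  by rewrite zS => /eqP; rewrite -subr_eq0 addrK expf_eq0 d_gt0 => /eqP.
case: q => [|q]; first by rewrite mul0n z0.
by rewrite mulSn (eventually_periodic_mul _ z_per) // k0.
Qed.

Variables (beta mu : R[i]) (v : nat -> R[i]).
Hypotheses (beta_root : beta ^+ d = 1) (beta_neq1 : beta != 1).
Hypotheses (v0 : v 0%N = 0) (v_per : eventually_periodic v k m)
  (vS : forall j, mu * v j.+1 = d%:R * z j ^+ d.-1 * v j + mu * v 1%N)
  (zb : z k = beta * z (k + m)%N) (vb : v k = beta * v (k + m)%N).
Variable i0 : nat.
Hypothesis vi0 : v i0 != 0.

(** The critical point has velocity 0: for k = 0 the boundary condition reads 0 = v_0 = beta v_m. *)
Let v_zero i : (0 < i)%N -> z i = 0 -> v i = 0.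
Proof.
have m0 := posnat_gt0 m.
move=> i_gt0 /(orbit_zero i_gt0)[k0 /dvdnP[[|q] iE]]; first by move: i_gt0; rewrite iE.
have vm : v m = 0.
  apply: (@mulfI _ beta); last by rewrite mulr0 -[RHS]v0 -[in RHS]k0 vb k0.
  apply/eqP => b0; move: beta_root; rewrite b0 expr0n eqn0Ngt d_gt0.
  by move/esym/eqP; rewrite oner_eq0.
by rewrite iE mulSn (eventually_periodic_mul _ v_per) // k0.
Qed.

Let mu_neq0 : mu != 0.
Proof.
apply/eqP => mu0; move: vi0; case: (i0) => [|i]; first by rewrite v0 eqxx.
have := vS i.+1; rewrite mu0 !mul0r addr0 => /esym/eqP.
rewrite !mulf_eq0 pnatr_eq0 eqn0Ngt d_gt0 /= expf_eq0 => /orP[/andP[_ /eqP zi]|->//].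
by rewrite v_zero // eqxx.
Qed.

Let v1_neq0 : v 1%N != 0.
Proof.
apply/eqP => v1; move: vi0; apply/negP/negPn/eqP.
elim: (i0) => [//|i IH]; apply: (mulfI mu_neq0).
by rewrite vS IH v1 !mulr0 addr0.
Qed.

Lemma eigenvalue_norm_ge1 : 1 <= complex.Re `|mu|.
Proof.
have m0 := posnat_gt0 m.
(* Velocity as a function of the point instead of the index. It is well defined: equal points have
   equal indices, or indices beyond k congruent modulo m, where v agrees. *)
pose V (a : R[i]) : R[i] :=
  if pselect (exists i, (0 < i)%N /\ z i = a) is left e then v (projT1 (cid e)) else 0.
have VE i : (0 < i)%N -> V (z i) = v i.
  move=> i_gt0; rewrite /V; case: pselect => [e|[]]; last by exists i.
  case: (cid e) => j [j0 zij] /=; have [ji|ji|->//] := ltngtP j i.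
    have [|kj /dvdnP[q qE]] := orbit_eq _ zij; first by rewrite j0.
    have -> : i = (j + q * m)%N by rewrite -qE subnKC // ltnW.
    by rewrite (eventually_periodic_mul _ v_per).
  have [|kj /dvdnP[q qE]] := orbit_eq _ (esym zij); first by rewrite i_gt0.
  have -> : j = (i + q * m)%N by rewrite -qE subnKC // ltnW.
  by rewrite (eventually_periodic_mul _ v_per).
pose Z := [seq z i | i <- iota 1 (k + m)].
have Zz i : (0 < i)%N -> z i \in Z.
  move=> i_gt0; rewrite (eventually_periodic_reduce i z_per); apply: map_f.
  by rewrite mem_iota reduce_gt0 // add1n ltnS reduce_le.
have ZP a : a \in Z -> exists2 i, (0 < i)%N & a = z i.
  by case/mapP => i; rewrite mem_iota => /andP[i_gt0 _] ->; exists i.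
apply: (@motion_eigenvalue_norm_ge1 R d (z 1%N) mu Z V d_ge2 (Zz 1%N isT) _ _ _ mu_neq0 (z 1%N)).
- by move=> a /ZP[i i_gt0 ->]; rewrite -zS; exact: Zz.
- by move=> a /ZP[i i_gt0 ->]; rewrite -zS !VE.
- by move=> /ZP[i i_gt0 zi]; rewrite zi VE // v_zero.
- exact: Zz.
- by rewrite VE.
Qed.

Lemma orbit_algint i : algint (z i).
Proof.
have m0 := posnat_gt0 m.
apply: (algint_orbit z0 zS); apply: (@algint_param _ d z d_ge2 z0 zS k (k + m)).
  by rewrite -[X in (X < _)%N]addn0 ltn_add2l.
by rewrite -addSn z_per.
Qed.

Lemma eigenvalue_norm_gt1 : 1 < `|mu|.
Proof.
have mu1 : `|mu| != 1.
  have [k0|k_gt0] := posnP k.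
    apply: (@eigenvalue_not_unimodular_periodic _ d z v mu d_ge2 z0 zS v1_neq0 vS
      (orbit_algint 1) m).
      exact: posnat_gt0.
    apply: v_zero; first exact: posnat_gt0.
    exact: orbit_period_zero.
  apply: (@eigenvalue_not_unimodular_preperiodic _ d z v mu d_ge2 z0 zS v1_neq0 vS (orbit_algint 1)
    beta beta_root beta_neq1 k.-1 m); rewrite ?prednK //; exact: posnat_gt0.
rewrite lt_def mu1 (normC_real (mu : (R[i] : numFieldType))) -[1]/(1%:C)%C lecR.
exact: eigenvalue_norm_ge1.
Qed.

End CriticalOrbit.

(** * The partial order *)

Lemma prec_refl : reflexive prec.
Proof. by move=> [k m]; rewrite /prec dvdnn eqxx. Qed.

Lemma prec_anti : antisymmetric prec.
Proof.
move=> [k m] [k' m'] /andP[/andP[/= mm' h] /andP[/= m'm h']].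
have -> : m = m' by apply: val_inj; apply/eqP; rewrite eqn_dvd mm' m'm.
congr (_, _); move: h h' => /orP[/eqP //|/andP[/eqP -> _]] /orP[/eqP //|/andP[/eqP -> _]] //.
Qed.

Lemma prec_trans : transitive prec.
Proof.
move=> [k' m'] [k m] [k2 m2] /andP[/= mm' h] /andP[/= m'm h'].
rewrite /prec /= (dvdn_trans mm' m'm) /=.
move: h h' => /orP[/eqP <-|/andP[/eqP -> mk]] /orP[/eqP <-|/andP[/eqP k0 mk2]].
- by rewrite eqxx.
- by rewrite k0 eqxx (dvdn_trans mm') ?orbT.
- by rewrite eqxx mk orbT.
- by rewrite eqxx (dvdn_trans mm' mk2) orbT.
Qed.

Section Inclusion.
Variables (R : realType) (beta : R[i]).
Hypotheses (beta0 : beta != 0) (beta1 : beta != 1).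

(* Only the inclusion matters: it is tested on the indicator of the non-multiples
   of m when k = 0, and on two sequences with value beta at k otherwise. *)
Lemma Mset_subset_prec k (m : posnat) k2 (m2 : posnat) :
  Mset beta k m `<=` Mset beta k2 m2 -> prec (k, m) (k2, m2).
Proof.
have m0 := posnat_gt0 m; have m20 := posnat_gt0 m2.
move=> sub; rewrite /prec /=; case: k sub => [|k] sub.
  have : Mset beta 0 m (fun i => (~~ (m %| i)%N)%:R).
    split; [by rewrite dvdn0 | | by rewrite add0n dvdnn dvdn0 mulr0 subr0].
    by move=> i _; rewrite dvdn_addl.
  move=> /sub [_ xP xb]; have mm2 : (m %| m2)%N.
    have km : (k2 < m * k2.+1)%N by rewrite (leq_trans (ltnSn k2)) // leq_pmull.
    have := xP _ km; rewrite dvdn_addr ?dvdn_mulr //=.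
    by case: (m %| m2)%N => // /eqP; rewrite oner_eq0.
  rewrite mm2 /=; move: xb; rewrite dvdn_addl //; case: (m %| k2)%N; first by rewrite orbT.
  rewrite mulr1 => /eqP; rewrite subr_eq0 (negPf beta1) //.
have -> : (m %| m2)%N.
  have : Mset beta k.+1 m (fun i => if i == k.+1 then beta else
      if (k.+1 < i)%N then (m %| i - k.+1)%N%:R else 0).
    split=> // [i ki|].
      have N1 : (i + m == k.+1)%N = false by lia.
      have N2 : (i == k.+1)%N = false by lia.
      have L1 : (k.+1 < i + m)%N by lia.
      by rewrite N1 N2 L1 ki -addnBAC 1?ltnW // dvdn_addl.
    have N1 : (k.+1 + m == k.+1)%N = false by lia.
    have L1 : (k.+1 < k.+1 + m)%N by lia.
    by rewrite N1 L1 addKn dvdnn eqxx mulr1 subrr.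
  move=> /sub [_ xP _]; have := xP (k.+1 + m * k2.+1)%N.
  have mk0 : (0 < m * k2.+1)%N by rewrite muln_gt0 m0.
  have N1 : (k.+1 + m * k2.+1 == k.+1)%N = false by lia.
  have N2 : (k.+1 + m * k2.+1 + m2 == k.+1)%N = false by lia.
  have L1 : (k.+1 < k.+1 + m * k2.+1)%N by lia.
  have L2 : (k.+1 < k.+1 + m * k2.+1 + m2)%N by lia.
  have L3 : (k2 < k.+1 + m * k2.+1)%N.
    by rewrite ltn_addl // (leq_trans (ltnSn k2)) // leq_pmull.
  rewrite N1 N2 L1 L2 addKn -addnA addKn dvdn_mulr // dvdn_addr ?dvdn_mulr //.
  by move/(_ L3); case: (m %| m2)%N => // /esym/eqP; rewrite oner_eq0.
(* Comparing with (k2, m2): k2 < k + 1 would let periodicity identify beta with 1, and k2 > k + 1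
   would turn the boundary condition into beta = 1. *)
have : Mset beta k.+1 m (fun i => if i == k.+1 then beta else (k.+1 < i)%N%:R).
  split=> // [i ki|].
    have N1 : (i + m == k.+1)%N = false by lia.
    have N2 : (i == k.+1)%N = false by lia.
    by rewrite N1 N2 ki ltn_addr.
  have N1 : (k.+1 + m == k.+1)%N = false by lia.
  have L1 : (k.+1 < k.+1 + m)%N by lia.
  by rewrite N1 L1 eqxx mulr1 subrr.
move=> /sub [_ xP xb]; rewrite /= orbF eqn_leq; apply/andP; split.
  rewrite leqNgt; apply/negP => kk; have := xP _ kk.
  have N1 : (k.+1 + m2 == k.+1)%N = false by lia.
  have L1 : (k.+1 < k.+1 + m2)%N by lia.
  by rewrite N1 L1 eqxx => /esym/eqP; rewrite (negPf beta1).
rewrite leqNgt; apply/negP => kk; move: xb.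
have N1 : (k2 + m2 == k.+1)%N = false by lia.
have N2 : (k2 == k.+1)%N = false by lia.
by rewrite N1 N2 kk ltn_addr // mulr1 => /eqP; rewrite subr_eq0 (negPf beta1).
Qed.

(** Only the boundary condition at (k, m) is at stake. If k = k2, the values at k + m and k + m2
    agree. If k = 0 < k2, the values at k2 and k2 + m2 both equal x_m, and beta <> 1 forces x_m =
    0. *)
Lemma Mset_periodic k (m : posnat) k2 (m2 : posnat) x : prec (k, m) (k2, m2) ->
  Mset beta k2 m2 x -> eventually_periodic x k m -> Mset beta k m x.
Proof.
have m0 := posnat_gt0 m; have m20 := posnat_gt0 m2.
move=> /andP[/= /dvdnP[q qE] kP] [x0 xP xb] xP'; split => //.
move: kP => /orP[/eqP kk|/andP[/eqP k0 /dvdnP[p pE]]].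
  rewrite -kk qE in xb; case: q qE xb => [|q] qE xb; first by move: m20; rewrite qE.
  rewrite mulSn addnA (eventually_periodic_mul _ xP') in xb; first by [].
  by rewrite -[X in (X < _)%N]addn0 ltn_add2l.
rewrite k0 add0n x0 subr0; rewrite k0 in xP'.
suff -> : x m = 0 by rewrite mulr0.
case: q qE => [|q] qE; first by move: m20; rewrite qE.
case: p pE => [|p] pE.
  move: xb; rewrite pE mul0n add0n qE mulSn (eventually_periodic_mul _ xP') //.
  by rewrite x0 subr0 => /eqP; rewrite mulf_eq0 (negPf beta0) => /eqP.
move: xb; rewrite qE pE -mulnDl addSn !mulSn !(eventually_periodic_mul _ xP') //.
rewrite -[X in _ - X]mul1r -mulrBl => /eqP; rewrite mulf_eq0 subr_eq0 (negPf beta1).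
by move=> /eqP.
Qed.

Lemma prec_Mset k (m : posnat) k2 (m2 : posnat) : prec (k, m) (k2, m2) ->
  Mset beta k m `<=` Mset beta k2 m2.
Proof.
have m0 := posnat_gt0 m; have m20 := posnat_gt0 m2.
move=> /andP[/= /dvdnP[q qE] kP] x [x0 xP xb].
have kk2 : (k <= k2)%N by case/orP: kP => [/eqP ->|/andP[/eqP -> _]].
split => //.
  by move=> i ki; rewrite qE (eventually_periodic_mul _ xP) // (leq_ltn_trans kk2).
move: kP => /orP[/eqP kk|/andP[/eqP k0 /dvdnP[p pE]]].
  rewrite -kk qE; case: q qE => [|q] qE; first by move: m20; rewrite qE.
  by rewrite mulSn addnA (eventually_periodic_mul _ xP) // -[X in (X < _)%N]addn0 ltn_add2l.
rewrite k0 add0n x0 subr0 in xb; rewrite k0 in xP.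
have xm0 : x m = 0 by apply: (mulfI beta0); rewrite xb mulr0.
have xq t : x (t * m)%N = 0.
  by case: t => [|t]; rewrite ?mul0n // mulSn (eventually_periodic_mul _ xP).
by rewrite qE pE -mulnDl !xq mulr0 subr0.
Qed.
End Inclusion.

Section Restriction.
Variables (R : realType) (d : nat) (beta : R[i]).
Hypotheses (d_ge2 : (2 <= d)%N) (beta_root : beta ^+ d = 1) (beta_neq1 : beta != 1).
Local Notation F := (Fmap d_ge2 beta_root beta_neq1).

(** Seen in the larger space, F k m y satisfies the equations that characterise F k2 m2 x. *)
Lemma Fmap_restriction k m k2 m2 (x : M beta k2 m2) (y : M beta k m) :
  Mset beta k m `<=` Mset beta k2 m2 -> x = y :> (nat -> R[i]) ->
  F k2 m2 x = F k m y :> (nat -> R[i]).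
Proof.
move=> sub xy; have /MpredP/sub/MpredP Fy := MseqP (F k m y).
suff -> : F k2 m2 x = MkM Fy by [].
apply/Fmap_spec; split; first by have /MpredP[_ _] := Fy.
by case=> // j _ /=; rewrite [LHS]FmapS subn1 xy.
Qed.

Lemma prec_restriction k m k2 m2 : prec (k, m) (k2, m2) <->
  [/\ Mset beta k m `<=` Mset beta k2 m2,
      forall x : M beta k2 m2, Mset beta k m x -> Mset beta k m (F k2 m2 x) &
      forall (x : M beta k2 m2) (y : M beta k m), x = y :> (nat -> R[i]) ->
        F k2 m2 x = F k m y :> (nat -> R[i])].
Proof.
have b0 := unity_root_neq0 d_ge2 beta_root.
split=> [/(prec_Mset b0) sub|[sub _ _]]; last exact: Mset_subset_prec sub.
split=> // [x xM|x y]; last exact: Fmap_restriction.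
have xM' : (x : nat -> R[i]) \in Mpred beta k m by apply/MpredP.
rewrite (@Fmap_restriction _ _ _ _ x (MkM xM') sub erefl).
by apply/MpredP; exact: MseqP.
Qed.
End Restriction.

(** * The annihilator *)

Lemma linear_map_sum (K : pzRingType) (U V : lmodType K) (f : U -> V) n (x : 'I_n -> U) :
  linear f -> f (\sum_(i < n) x i) = \sum_(i < n) f (x i).
Proof.
move=> fl; pose fM := GRing.isLinear.Build _ _ _ _ _ fl.
pose g : {linear U -> V} := HB.pack f fM.
exact: (linear_sum g).
Qed.

Lemma linear_map_scale (K : pzRingType) (U V : lmodType K) (f : U -> V) a x :
  linear f -> f (a *: x) = a *: f x.
Proof.
move=> fl; pose fM := GRing.isLinear.Build _ _ _ _ _ fl.
pose g : {linear U -> V} := HB.pack f fM.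
by have := linearZZ g a x.
Qed.

Lemma prod_window (K : comPzRingType) (f : nat -> K) k m i : eventually_periodic f k m ->
  (k < i)%N -> \prod_(t < m) f (i + t)%N = \prod_(t < m) f (k.+1 + t)%N.
Proof.
case: m => [|m] fP ki; first by rewrite !big_ord0.
rewrite -(subnKC ki); elim: (i - k.+1)%N => [|j IH]; first by rewrite addn0.
rewrite -IH big_ord_recr big_ord_recl /= mulrC addn0; congr (_ * _).
  rewrite -[in RHS]fP; last by rewrite addSn ltnS leq_addr.
  by congr f; lia.
by apply: eq_bigr => t _; congr f; rewrite /bump /=; lia.
Qed.

Lemma sum_window (V : nmodType) (f : nat -> V) m c : (forall t, f (t + m)%N = f t) ->
  \sum_(t < m) f (t + c)%N = \sum_(t < m) f t.
Proof.
case: m => [|m] fP; first by rewrite !big_ord0.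
elim: c => [|c IH]; first by apply: eq_bigr => t _; rewrite addn0.
rewrite -IH big_ord_recr big_ord_recl /= addrC; congr (_ + _).
  by rewrite add0n -(fP c); congr f; lia.
by apply: eq_bigr => t _; congr f; rewrite /bump /=; lia.
Qed.

(** * Spectrum on the annihilator, from the recursion of the derivative alone *)

Section Cocycle.
Variables (R : realType) (d : nat) (beta : R[i]).
Hypotheses (d_ge2 : (2 <= d)%N) (beta_root : beta ^+ d = 1) (beta_neq1 : beta != 1).
Variables (k : nat) (m : posnat) (z : nat -> R[i]) (T : M beta k m -> M beta k m).
Hypotheses (z0 : z 0%N = 0) (zS : forall j, z j.+1 = z j ^+ d + z 1%N).
Let delta j : R[i] := d%:R * z j ^+ d.-1.
Hypotheses (TS : forall v j, T v j.+1 = delta j * v j + T v 1%N :> R[i]).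
Variables (k' : nat) (m' : posnat).
Hypotheses (z_preper : preperiod_period z k' m') (km : prec (k', m') (k, m)).

Let b0 : beta != 0. Proof. exact: unity_root_neq0 beta_root. Qed.
Let d0 : (0 < d)%N. Proof. exact: ltnW. Qed.
Let m0 : (0 < m)%N. Proof. exact: posnat_gt0. Qed.
Let m'0 : (0 < m')%N. Proof. exact: posnat_gt0. Qed.
Let mm : (m' %| m)%N. Proof. by case/andP: km. Qed.
Let z_per : eventually_periodic z k' m'. Proof. by case: z_preper. Qed.

Let M_of_periodic (x : M beta k m) : eventually_periodic x k' m' -> Mset beta k' m' x.
Proof.
by move=> xP; apply: (Mset_periodic b0 beta_neq1 km) => //; apply/MpredP; exact: MseqP.
Qed.

Let delta_per : eventually_periodic delta k' m'.
Proof. by move=> i ki; rewrite /delta z_per. Qed.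

Let delta_eq0 i : z i = 0 -> delta i = 0.
Proof. by rewrite /delta => ->; rewrite expr0n; case: d d_ge2 => [|[|e]] //; rewrite mulr0. Qed.

(** The delicate index is k', where v and z differ from their values at k' + m' by a factor beta:
    the product [delta] times v then picks up beta ^ d = 1. *)
Lemma cocycle_stable (v : M beta k m) : z k' = beta * z (k' + m')%N -> Mset beta k' m' v ->
  Mset beta k' m' (T v).
Proof.
move=> zb [v0 vP /eqP]; rewrite subr_eq0 => /eqP vb.
apply: M_of_periodic => -[//|i] ki; rewrite addSn [LHS]TS [RHS]TS; congr (_ + _).
move: ki; rewrite ltnS leq_eqVlt => /orP[/eqP <-|ki]; last by rewrite delta_per // vP.
rewrite -vb /delta zb exprMn.
transitivity (beta ^+ d * (d%:R * z (k' + m')%N ^+ d.-1 * v (k' + m')%N) : R[i]).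
  by rewrite beta_root mul1r.
have -> : beta ^+ d = beta * beta ^+ d.-1 by rewrite -exprS prednK.
by ring.
Qed.

Section Periodic.
Hypotheses (z1 : z 1%N != 0) (k'0 : k' = 0%N).

Let delta_mul q : delta (q * m')%N = 0.
Proof.
apply: delta_eq0; apply: (orbit_period_zero d_ge2 z0 zS z_preper k'0).
by rewrite dvdn_mull.
Qed.

Let delta_shift q i : (0 < i)%N -> delta (q * m' + i)%N = delta i.
Proof. by move=> i0; rewrite addnC (eventually_periodic_mul _ delta_per) // k'0. Qed.

(** The weight [delta] vanishes at multiples of m', so each block of length m' restarts afresh:
    after n iterations the first n entries of every block agree with those of the first one. *)
Lemma cocycle_nilpotent v : Mset beta k' m' (iter m' T v).
Proof.
have H n q i : (0 < i <= n)%N -> iter n T v (q * m' + i)%N = iter n T v i.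
  elim: n i => [|n IH] i; first by lia.
  case: i => // i; rewrite addnS ltnS /= => iN.
  rewrite [LHS]TS [RHS]TS; case: i iN => [|i] iN.
    by rewrite addn0 delta_mul (delta_eq0 z0) !mul0r.
  by rewrite delta_shift // IH.
apply: M_of_periodic; rewrite k'0 => i i0.
have /= iE := prednK i0; rewrite -iE (divn_eq i.-1 m').
have r0 : (0 < (i.-1 %% m').+1 <= m')%N by rewrite /= ltn_mod.
rewrite -addnS (H _ _ _ r0) addnAC -mulSnr.
exact: H.
Qed.

Lemma period_ge2 : (2 <= m')%N.
Proof.
rewrite ltn_neqAle m'0 andbT; apply/eqP => m1.
by move: z1; rewrite (orbit_period_zero d_ge2 z0 zS z_preper k'0) ?eqxx // -m1.
Qed.

Lemma Spec_periodic : (k, m) <> (k', m') ->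
  Spec (annihilator k' m') (transpose T) = [set 0].
Proof.
move=> kmk'; apply/seteqP; split => [a [om [[oml om0] omn0 omT]]|_ ->].
- have omTx x : om (T x) = a * om x by have := congr1 (fun f => f x) omT.
  have iterT n x : om (iter n T x) = a ^+ n * om x.
    by elim: n => [|n IH]; rewrite /= ?mul1r // omTx IH exprS mulrA.
  apply/eqP; apply: contraT => a0; case/negP: omn0; apply/eqP/funext => x.
  apply: (mulfI (expf_neq0 m' a0)); rewrite -iterT om0 ?mulr0 //.
  exact: cocycle_nilpotent.
(* T x takes equal values at m' + 1 and at 1, the weight at m' being 0, so this form is killed by
   the transpose. It is nonzero since m' >= 2 and k + m >= 2 m' make m' + 1 a free coordinate. *)
- pose om (x : M beta k m) : R[i]^o := x m'.+1 - x 1%N.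
  have m2 := period_ge2.
  have m'n : (m'.+1 <= k + m - 1)%N.
    have [q qE] := dvdnP mm; case: q qE => [|q] qE; first by move: m0; rewrite qE.
    have [k0|k_gt0] := posnP k.
      case: q qE => [|q] qE; last by rewrite k0 qE !mulSn; lia.
      case: kmk'; rewrite k0 k'0; congr (_, _); apply: val_inj.
      by rewrite /= qE mul1n.
    have m'k : (m' <= k)%N.
      apply: dvdn_leq => //; case/andP: km => _ /= /orP[/eqP kE|/andP[_ //]].
      by move: k_gt0; rewrite -kE k'0.
    by rewrite qE mulSn; lia.
  exists om; split.
  + split.
      move=> a x y; rewrite /om.
      transitivity ((a * x m'.+1 + y m'.+1) - (a * x 1%N + y 1%N) : R[i]); first by [].
      by transitivity (a * (x m'.+1 - x 1%N) + (y m'.+1 - y 1%N) : R[i]); first by ring.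
    move=> x [_ xP _]; rewrite /om -[m'.+1]add1n xP ?subrr // k'0 //.
  + apply/eqP => /(congr1 (fun f => f (ofcoords beta k m (fun j => (j == m'.+1)%:R)))).
    rewrite /om !(ofcoordsE b0) ?eqxx; try by lia.
    rewrite (_ : (1 == m'.+1)%N = false) ?subr0; last by lia.
    by move/eqP; rewrite oner_eq0.
  + apply/funext => x; rewrite [RHS](_ : _ = 0); last by rewrite scale0r.
    rewrite /transpose /= /om [T x m'.+1]TS -[m' : nat]mul1n delta_mul mul0r add0r.
    exact: subrr.
Qed.
End Periodic.

Section Preperiodic.
Hypothesis k'_gt0 : (0 < k')%N.
Variable lambda : R[i].
Hypothesis lambdaE : lambda = \prod_(t < m') delta (k'.+1 + t)%N.

Let kk : k = k'.
Proof.
case/andP: km => _ /= /orP[/eqP ->//|/andP[/eqP k0 _]].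
by move: k'_gt0; rewrite k0.
Qed.

Let z_neq0 i : (0 < i)%N -> z i != 0.
Proof.
move=> i0; apply/eqP => /(orbit_zero d_ge2 zS z_preper i0)[k0 _].
by move: k'_gt0; rewrite k0.
Qed.

Let delta_neq0 i : (0 < i)%N -> delta i != 0.
Proof. by move=> i0; rewrite mulf_neq0 ?pnatr_eq0 -?lt0n ?expf_neq0 // z_neq0. Qed.

Let lambda_neq0 : lambda != 0.
Proof. by rewrite lambdaE; apply/prodf_neq0 => t _; exact: delta_neq0. Qed.

Let s := (m %/ m')%N.
Let mE : m = (s * m')%N :> nat. Proof. by rewrite divnK. Qed.

Let window i : (k' < i)%N -> \prod_(t < m') delta (i + t)%N = lambda.
Proof. by move=> ki; rewrite (prod_window delta_per ki). Qed.

Let defect (v : M beta k m) i : R[i] := v (i + m')%N - v i.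

Let defectT v i : (k' < i)%N -> defect (T v) i.+1 = delta i * defect v i.
Proof.
move=> ki; rewrite /defect addSn [T v (i + m').+1]TS [T v i.+1]TS delta_per //.
by ring.
Qed.

Let defect_iter v i n : (k' < i)%N ->
  defect (iter n T v) (i + n)%N = (\prod_(t < n) delta (i + t)%N) * defect v i.
Proof.
move=> ki; elim: n => [|n IH]; first by rewrite addn0 big_ord0 mul1r.
rewrite addnS /= defectT ?ltn_addr // IH big_ord_recr /= mulrA; congr (_ * _).
exact: mulrC.
Qed.

Let defect_iter_mul v i j : (k' < i)%N ->
  defect (iter (j * m') T v) (i + j * m')%N = lambda ^+ j * defect v i.
Proof.
move=> ki; elim: j => [|j IH]; first by rewrite mul0n addn0 mul1r.
rewrite mulSn iterD addnA addnAC defect_iter ?ltn_addr //.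
by rewrite window ?ltn_addr // IH exprS mulrA.
Qed.

Let M_of_defect (v : M beta k m) : (forall i, (k' < i)%N -> defect v i = 0) ->
  Mset beta k' m' v.
Proof.
move=> v0; apply: M_of_periodic => i ki; apply/eqP; rewrite -subr_eq0; apply/eqP.
exact: v0.
Qed.

Let defect_per v i : (k' < i)%N -> defect v (i + m)%N = defect v i.
Proof.
move=> ki; rewrite /defect addnAC !(@M_periodic _ _ _ _ v) // kk ?ltn_addr //.
Qed.

Let defectB (v u : M beta k m) c i :
  defect (v - c *: u) i = defect v i - c * defect u i.
Proof.
transitivity ((v (i + m')%N - c * u (i + m')%N) - (v i - c * u i) : R[i]); first by [].
by rewrite /defect; ring.
Qed.

Let defect_sum n (c : 'I_n -> R[i]) (v : 'I_n -> M beta k m) i :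
  defect (\sum_(j < n) c j *: v j) i = \sum_(j < n) c j * defect (v j) i.
Proof.
rewrite /defect !Mcoord_sum -sumrB; apply: eq_bigr => j _.
by rewrite mulrBr.
Qed.

(** Coefficients of the eigenform on the coordinates k' + 1 + t: the solution with initial value 1
    of the transposed recursion [kappaS]. *)
Let kappa a t : R[i] := a ^+ t / \prod_(l < t) delta (k'.+1 + l)%N.

Let kappaS a t : kappa a t.+1 * delta (k'.+1 + t)%N = a * kappa a t.
Proof.
rewrite /kappa; set p := \prod_(l < t) _.
have -> : \prod_(l < t.+1) delta (k'.+1 + l)%N = p * delta (k'.+1 + t)%N.
  by rewrite big_ord_recr.
rewrite exprS invfM.
have dn : delta (k'.+1 + t)%N != 0 by exact: delta_neq0.
by move: (delta _) dn => D dn; rewrite !mulrA divfK.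
Qed.

Let kappaD a t : kappa a (t + m')%N = a ^+ m' / lambda * kappa a t.
Proof.
rewrite /kappa exprD; have -> : \prod_(l < t + m') delta (k'.+1 + l)%N
    = (\prod_(l < t) delta (k'.+1 + l)%N) * lambda.
  rewrite big_split_ord /= -(window (i := (k'.+1 + t)%N)) ?ltn_addr //; congr (_ * _).
  by apply: eq_bigr => l _; rewrite addnA.
by rewrite invfM mulrACA mulrC.
Qed.

Let kappa_per a t : a ^+ m = lambda ^+ s -> kappa a (t + m)%N = kappa a t.
Proof.
move=> am; have kq q : kappa a (t + q * m')%N = (a ^+ m' / lambda) ^+ q * kappa a t.
  elim: q => [|q IH]; first by rewrite mul0n addn0 mul1r.
  by rewrite mulSn addnA addnAC kappaD IH exprS mulrA.
rewrite {1}mE kq expr_div_n -exprM mulnC -mE am divff ?mul1r //.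
by rewrite expf_neq0.
Qed.

(** Shifting t by m' preserves the sum over a period but multiplies it by a ^ m' / lambda, which is
    not 1. *)
Let kappa_sum a (g : nat -> R[i]) : a ^+ m = lambda ^+ s -> a ^+ m' != lambda ->
  (forall t, g (t + m')%N = g t) -> \sum_(t < m) kappa a t * g t = 0.
Proof.
move=> am am' gP; set S := \sum_(t < m) _.
have gm t : g (t + m)%N = g t.
  rewrite mE; elim: (s) => [|q IH]; first by rewrite mul0n addn0.
  by rewrite mulSn addnA addnAC gP.
have SE : S = a ^+ m' / lambda * S.
  rewrite {1}/S -(sum_window (f := fun t => kappa a t * g t) m') => [|t].
    by rewrite /S mulr_sumr; apply: eq_bigr => t _; rewrite gP kappaD mulrA.
  by rewrite kappa_per // gm.
apply/eqP; move/eqP: SE; rewrite -subr_eq0 -{1}[S]mul1r -mulrBl mulf_eq0.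
case/orP => //; rewrite subr_eq0 => /eqP/(congr1 ( *%R^~ lambda)).
by rewrite mul1r divfK // => E; rewrite -E eqxx in am'.
Qed.

(** T ^ m multiplies defects by lambda ^ s, so T ^ m x - lambda ^ s x lies in the subspace killed by
    [om]; this is the first condition. For the second, a combination of iterates with zero defect is
    tested. *)
Let Spec_sub a (om : M beta k m -> R[i]^o) : annihilator k' m' om -> om != 0 ->
  (forall x, om (T x) = a * om x :> R[i]) -> a ^+ m = lambda ^+ s /\ a ^+ m' != lambda.
Proof.
move=> [oml om0] omn0 omT.
have iterT n x : om (iter n T x) = a ^+ n * om x :> R[i].
  by elim: n => [|n IH]; rewrite /= ?mul1r // omT IH exprS mulrA.
have [x omx] : exists x, om x != 0 :> R[i].
  apply: contrapT => /forallNP H; case/negP: omn0; apply/eqP/funext => x.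
  by apply/eqP; apply: contrapT => h; apply: (H x); exact/negP.
split.
  have y0 : om (iter m T x - lambda ^+ s *: x) = 0.
    apply: om0; apply: M_of_defect => i ki.
    have E : defect (iter m T x) i = lambda ^+ s * defect x i.
      by rewrite -defect_per // {1 2}mE defect_iter_mul.
    by rewrite defectB E subrr.
  have : om (iter m T x - lambda ^+ s *: x) = (a ^+ m - lambda ^+ s) * om x :> R[i].
    rewrite -scaleNr addrC oml iterT.
    transitivity (- lambda ^+ s * om x + a ^+ m * om x : R[i]); first by [].
    by ring.
  rewrite y0 => /esym/eqP; rewrite mulf_eq0 (negPf omx) orbF subr_eq0.
  by move/eqP.
apply/eqP => am'.
(* If a ^ m' = lambda, each term contributes [om x] to [om y], giving s times it. The defect of y
   telescopes over a full period m, however, so [om y] is 0. *)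
pose y := \sum_(j < s) lambda ^- j *: iter (j * m') T x.
have y0 : om y = 0.
  (* Moving the index up by m leaves room to step back by j * m' and still be beyond k'. *)
  apply: om0; apply: M_of_defect => i ki; rewrite -defect_per //.
  have : defect y (i + m)%N = \sum_(j < s) lambda ^- j * defect (iter (j * m') T x) (i + m)%N.
    exact: defect_sum.
  move=> ->.
  transitivity (\sum_(j < s) (x (i + (s - j).+1 * m')%N - x (i + (s - j) * m')%N)).
    apply: eq_bigr => j _.
    have -> : (i + m)%N = (i + (s - j) * m' + j * m')%N.
      by rewrite -addnA -mulnDl subnK ?mE // ltnW.
    rewrite defect_iter_mul ?ltn_addr // mulKf ?expf_neq0 // /defect.
    by congr (x _ - _); rewrite mulSn; lia.
  rewrite (reindex_inj rev_ord_inj) /=.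
  transitivity (\sum_(j < s) (x (i + j.+2 * m')%N - x (i + j.+1 * m')%N)).
    by apply: eq_bigr => j _; rewrite subKn.
  have := telescope_sumr (fun j => x (i + j.+1 * m')%N) (leq0n s); rewrite big_mkord => ->.
  rewrite mulSn -mE addnA (@M_periodic _ _ _ _ x) ?mul1n ?subrr //.
  by rewrite kk ltn_addr.
have : om y = \sum_(j < s) om x.
  rewrite /y linear_map_sum //; apply: eq_bigr => j _.
  rewrite linear_map_scale // iterT mulnC exprM am'.
  by apply: mulKf; rewrite expf_neq0.
rewrite y0 sumr_const card_ord => /esym/eqP; rewrite mulrn_eq0 (negPf omx) orbF.
by move=> /eqP s0; move: m0; rewrite mE s0.
Qed.

Lemma Spec_preperiodic : (k, m) <> (k', m') ->
  Spec (annihilator k' m') (transpose T) =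
    [set a | a ^+ m = lambda ^+ (m %/ m') /\ a ^+ m' != lambda].
Proof.
move=> kmk'; apply/seteqP; split => [a [om [omA omn0 omT]]|a [am am']].
  apply: (Spec_sub omA omn0) => x.
  by have := congr1 (fun f => f x) omT.
(* This makes k + 1 a free coordinate, on which the eigenform below is seen to be nonzero. *)
have m2 : (2 <= m)%N.
  rewrite ltn_neqAle m0 andbT; apply/eqP => m1; case: kmk'; rewrite kk; congr (_, _).
  apply: val_inj; rewrite /= -m1; apply/esym/eqP; rewrite -dvdn1 [X in (_ %| X)%N]m1.
  exact: mm.
pose om (x : M beta k m) : R[i]^o := \sum_(t < m) kappa a t * x (k.+1 + t)%N.
exists om; split.
- split.
    move=> c x y; transitivity (c * om x + om y : R[i]); last by [].
    rewrite /om mulr_sumr -big_split; apply: eq_bigr => t _.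
    transitivity (kappa a t * (c * x (k.+1 + t)%N + y (k.+1 + t)%N) : R[i]); first by [].
    by rewrite mulrDr mulrCA.
  move=> x [_ xP _]; apply: (kappa_sum (g := fun t => x (k.+1 + t)%N)) => // t.
  by rewrite addnA xP // kk ltn_addr.
- apply/eqP => /(congr1 (fun f => f (ofcoords beta k m (fun j => (j == k.+1)%:R)))).
  set e := ofcoords _ _ _ _; rewrite /om (bigD1 (Ordinal m0)) //= big1 => [|t t0].
    rewrite /kappa big_ord0 expr0 divr1 mul1r addn0 /e (ofcoordsE b0); last by lia.
    by rewrite eqxx => /eqP; rewrite Monoid.mulm1 oner_eq0.
  have {}t0 : (0 < t)%N by rewrite lt0n; move: t0; rewrite -val_eqE.
  suff -> : e (k.+1 + t)%N = 0 by rewrite mulr0.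
  have tm := ltn_ord t; have k0 : (0 < k)%N by rewrite kk.
  have [tn|tn] := ltnP (k.+1 + t) (k + m).
    rewrite (ofcoordsE b0); last by lia.
    by rewrite (_ : (_ == _) = false) //; lia.
  have -> : (k.+1 + t = k + m)%N by lia.
  apply: (mulfI b0); rewrite -M_boundary mulr0 (ofcoordsE b0); last by lia.
  by rewrite (_ : (_ == _) = false) //; lia.
- apply/funext => x.
  pose g t := kappa a t * T x (k.+1 + t)%N.
  have : \sum_(t < m) g (t + 1)%N = \sum_(t < m) g t.
    apply: sum_window => t; rewrite /g kappa_per // addnA (@M_periodic _ _ _ _ (T x)) //.
    by rewrite ltn_addr.
  move=> gE; transitivity (\sum_(t < m) g t); first by [].
  rewrite -gE.
  transitivity (\sum_(t < m) (a * (kappa a t * x (k.+1 + t)%N) + kappa a t.+1 * T x 1%N)).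
    apply: eq_bigr => t _; have kS : kappa a t.+1 * delta (k.+1 + t)%N = a * kappa a t.
      by rewrite kk kappaS.
    by rewrite /g addn1 addnS [T x _]TS mulrDr mulrA kS -mulrA.
  rewrite big_split /= -mulr_sumr.
  (* The common summand T x 1 of the recursion drops out because the constant sequence 1 is
     m'-periodic and so has zero [kappa]-sum. *)
  suff -> : \sum_(t < m) kappa a t.+1 * T x 1%N = 0 by exact: addr0.
  rewrite -mulr_suml.
  have -> : \sum_(t < m) kappa a t.+1 = \sum_(t < m) kappa a t.
    rewrite -(sum_window (f := kappa a) 1) => [|t]; last exact: kappa_per.
    by apply: eq_bigr => t _; rewrite addn1.
  have := kappa_sum (g := fun=> 1) am am' (fun=> erefl).
  by under eq_bigr do rewrite mulr1; move=> ->; rewrite mul0r.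
Qed.
End Preperiodic.
End Cocycle.

(** * The theorem *)

Section Unicritical.
Variables (K : numFieldType) (d : nat) (c : K).
Hypothesis d_ge2 : (2 <= d)%N.
Let P : {poly K} := 'X ^+ d + c%:P.

Let P_horner x : P.[x] = x ^+ d + c. Proof. by rewrite !hornerE. Qed.

Let P_deriv x : P^`().[x] = d%:R * x ^+ d.-1.
Proof. by rewrite derivD derivC addr0 derivXn hornerMn hornerXn mulr_natl. Qed.

Lemma unicritical_root x : root P^`() x = (x == 0).
Proof.
rewrite rootE P_deriv mulf_eq0 pnatr_eq0 expf_eq0; move: d_ge2.
by case: (d) => [|[|e]] //.
Qed.

Lemma unicritical_value : critical_values P = [set c].
Proof.
have P0 : P.[0] = c by rewrite P_horner expr0n eqn0Ngt (ltnW d_ge2) add0r.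
apply/seteqP; split => [y [x /=]|y ->].
  by rewrite unicritical_root => /eqP x0 <-; rewrite x0.
by exists 0 => //=; rewrite unicritical_root.
Qed.

Lemma iter_poly_deriv n x :
  (iter_poly P n)^`().[x] = \prod_(t < n) (d%:R * (iter t (horner P) x) ^+ d.-1).
Proof.
elim: n x => [|n IH] x; first by rewrite big_ord0 derivX hornerC.
rewrite /iter_poly iterS -/(iter_poly P n) deriv_comp hornerM horner_comp IH P_deriv.
rewrite big_ord_recl mulrC; congr (_ * _).
by apply: eq_bigr => t _; rewrite -iterSr.
Qed.
End Unicritical.

Section FixedPoint.
Variables (R : realType) (d : nat) (beta : R[i]).
Hypotheses (d_ge2 : (2 <= d)%N) (beta_root : beta ^+ d = 1) (beta_neq1 : beta != 1).
Local Notation F := (Fmap d_ge2 beta_root beta_neq1).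
Variables (k : nat) (m : posnat) (z : M beta k m).
Hypotheses (z_neq0 : z != 0) (z_fixed : F k m z = z).
Variables (k' : nat) (m' : posnat).
Hypothesis z_preper : preperiod_period z k' m'.

Let b0 : beta != 0. Proof. exact: unity_root_neq0 beta_root. Qed.
Let d_gt0 : (0 < d)%N. Proof. exact: ltnW. Qed.

Lemma fixed_orbit j : z j.+1 = z j ^+ d + z 1%N :> R[i].
Proof. by rewrite -{1 3}z_fixed FmapS. Qed.

Lemma fixed_neq0 : z 1%N != 0 :> R[i].
Proof.
apply/eqP => z1; case/negP: z_neq0; apply/eqP/(M_ext b0) => j _.
elim: j => [|j IH]; first by rewrite M0.
by rewrite fixed_orbit z1 IH expr0n eqn0Ngt d_gt0 addr0.
Qed.

(** If k' < k, then z_k = z_(k+m) and the boundary condition with beta <> 1 gives z_k = 0. The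
    critical point is then periodic, so k' = 0 and m' divides k. *)
Lemma fixed_prec : prec (k', m') (k, m).
Proof.
have m0 := posnat_gt0 m.
have [kk mm] := eventually_periodic_dvdn z_preper m0 (@M_periodic _ _ _ _ z).
rewrite /prec /= mm /=; have [//|k'k] := eqVneq k' k.
have k'ltk : (k' < k)%N by rewrite ltn_neqAle k'k.
have [q qE] := dvdnP mm; have [z_per _] := z_preper.
have zk : z k = 0 :> R[i].
  have := M_boundary z; rewrite qE (eventually_periodic_mul _ z_per) // => /eqP.
  rewrite -subr_eq0 -{1}[z k]mul1r -mulrBl mulf_eq0 subr_eq0 eq_sym (negPf beta_neq1).
  by move/eqP.
have k_gt0 : (0 < k)%N by exact: leq_ltn_trans k'ltk.
have [k'0 mk] := orbit_zero d_ge2 fixed_orbit z_preper k_gt0 zk.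
by rewrite k'0 mk eqxx.
Qed.

Lemma fixed_Mset : Mset beta k' m' z.
Proof.
apply: (Mset_periodic b0 beta_neq1 fixed_prec); last by case: z_preper.
by apply/MpredP; exact: MseqP.
Qed.
End FixedPoint.

Unset Implicit Arguments.

Theorem theorem2 (R : realType) (d : nat) (beta : R[i])
    (d_ge2 : (2 <= d)%N) (beta_root : beta ^+ d = 1) (beta_neq1 : beta != 1)
    (k : nat) (m : posnat) (z : M beta k m) (z_neq0 : z != 0)
    (z_fixed : Fmap d_ge2 beta_root beta_neq1 k m z = z)
    (k' : nat) (m' : posnat) (z_preper : preperiod_period z k' m') :
  let F (k : nat) (m : posnat) : M beta k m -> M beta k m :=
    Fmap d_ge2 beta_root beta_neq1 k m in
  let P : {poly R[i]} := ('X : {poly R[i]}) ^+ d + (z 1%N)%:P in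
  let lambda : R[i] := multiplier P (z 1%N) k' m' in
  [/\
    (* (1) *)
    [/\ post_critically_finite P,
        forall j : nat, (1 <= j)%N -> z j = iter j (horner P) 0,
        critical_values P = [set z 1%N] &
        preperiodic_to_cycle P (z 1%N) k' m'],
    (* (2) *)
    [/\ reflexive prec, antisymmetric prec, transitive prec &
        forall (k1 : nat) (m1 : posnat) (k2 : nat) (m2 : posnat),
          prec (k1, m1) (k2, m2) <->
          [/\ Mset beta k1 m1 `<=` Mset beta k2 m2,
              forall x : M beta k2 m2,
                Mset beta k1 m1 x -> Mset beta k1 m1 (F k2 m2 x) &
              forall (x : M beta k2 m2) (y : M beta k1 m1),
                x = y :> (nat -> R[i]) ->
                F k2 m2 x = F k1 m1 y :> (nat -> R[i])]],
    (* (3) *)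
    (2 <= k + m - 1)%N ->
      holomorphically_conjugate (F k m) (Gmap d beta k m),
    (* (4) *)
    exists z' : M beta k' m',
      [/\ z' = z :> (nat -> R[i]), F k' m' z' = z' &
          forall mu : R[i], Spec setT ('d (F k' m') z') mu -> 1 < `|mu|] &
    (* (5) *)
    (k, m) <> (k', m') ->
      let DFt := transpose ('d (F k m) z) in
      [/\ Mset beta k' m' `<=` Mset beta k m,
          forall om, annihilator k' m' om -> annihilator k' m' (DFt om) &
          Spec (annihilator k' m') DFt =
            if k' == 0%N then [set 0]
            else [set mu | mu ^+ m = lambda ^+ (m %/ m') /\
                           mu ^+ m' != lambda]]].
Proof.
move=> F P lambda.
have b0 : beta != 0 by exact: unity_root_neq0 d_ge2 beta_root.
have zS := fixed_orbit z_fixed.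
have z1 := fixed_neq0 z_neq0 z_fixed.
have km := fixed_prec z_fixed z_preper.
have zM := fixed_Mset z_fixed z_preper.
have iterP i t : iter t (horner P) (z i) = z (i + t)%N.
  elim: t => [|t IH]; first by rewrite addn0.
  by rewrite iterS IH addnS zS !hornerE.
have P_iter j : (1 <= j)%N -> z j = iter j (horner P) 0.
  by move=> _; rewrite -(M0 z) iterP.
have iterPc i : (0 < i)%N -> iter i.-1 (horner P) (z 1%N) = z i.
  by move=> i0; rewrite iterP add1n prednK.
have lambdaE : lambda = \prod_(t < m') (d%:R * z (k'.+1 + t)%N ^+ d.-1).
  rewrite /lambda /multiplier iter_poly_deriv //; apply: eq_bigr => t _.
  by rewrite -iterD iterP add1n addSn addnC.
split.
- split=> //.
  + move=> c; rewrite unicritical_root // => /eqP ->.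
    (* The indices up to k + m represent the whole orbit; index 0 is the critical point itself. *)
    apply: (@sub_finite_set _ _ (z @` `I_(k + m).+1)).
      move=> y [n _ <-]; rewrite -(M0 z) iterP add0n.
      exists (reduce k m n); last by rewrite -eventually_periodic_reduce //; exact: M_periodic.
      by rewrite /= ltnS reduce_le // posnat_gt0.
    exact/finite_image/finite_II.
  + exact: unicritical_value.
  + have [zP zmin] := z_preper; split.
      move=> i ki; have i0 : (0 < i)%N by exact: leq_ltn_trans ki.
      by rewrite (iterPc i) // (iterPc (i + m')%N) ?ltn_addr // zP.
    move=> k1 m1 zP1; apply: zmin => i ki.
    have i0 : (0 < i)%N by exact: leq_ltn_trans ki.
    by rewrite -(iterPc i) // -(iterPc (i + m1)%N) ?ltn_addr //; exact: zP1.
- split; [exact: prec_refl | exact: prec_anti | exact: prec_trans |].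
  exact: prec_restriction.
- by move=> _; exact: Fmap_conjugate_Gmap.
- have zM' : (z : nat -> R[i]) \in Mpred beta k' m' by apply/MpredP.
  exists (MkM zM'); split => //.
    have E := @Fmap_restriction R d beta d_ge2 beta_root beta_neq1 k' m' k m z (MkM zM')
      (prec_Mset b0 km) erefl.
    apply: val_inj; apply: etrans (esym E) _; by rewrite z_fixed.
  move=> mu [v [_ v0 Tv]].
  have [i vi] : exists i, v i != 0 :> R[i].
    apply: contrapT => /forallNP H; case/negP: v0; apply/eqP/(M_ext b0) => i _.
    by apply/eqP; apply: contrapT => h; apply: (H i); exact/negP.
  apply: (@eigenvalue_norm_gt1 R d z d_ge2 (M0 z) zS k' m' z_preper beta mu v beta_root
    beta_neq1 (M0 v) (@M_periodic _ _ _ _ v) _ _ (M_boundary v) i vi).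
    move=> j; have := diff_FmapS d_ge2 beta_root beta_neq1 (MkM zM') v j.
    by rewrite -/F Tv.
  by case: zM => _ _ /eqP; rewrite subr_eq0 => /eqP.
- move=> kmk' DFt.
  have TS v j : ('d (F k m) z v) j.+1 = d%:R * z j ^+ d.-1 * v j + ('d (F k m) z v) 1%N.
    exact: diff_FmapS.
  split.
  + exact: (prec_Mset b0 km).
  + move=> om [oml om0]; split.
      move=> a x y; apply: etrans (oml a _ _).
      by apply: (congr1 om); exact: linearP.
    move=> x xM; apply: om0; apply: (cocycle_stable d_ge2 beta_root beta_neq1 TS z_preper km) => //.
    by case: zM => _ _ /eqP; rewrite subr_eq0 => /eqP.
  + have [k'0|k'0] := eqVneq k' 0%N.
      exact: (Spec_periodic d_ge2 beta_root beta_neq1 (M0 z) zS TS z_preper km z1 k'0 kmk').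
    have k'_gt0 : (0 < k')%N by rewrite lt0n.
    exact: (Spec_preperiodic d_ge2 beta_root beta_neq1 zS TS z_preper km k'_gt0 lambdaE kmk').
Qed.
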